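(* Let $(\Gamma,\mu)$ be a weighted graph satisfying (DV) and (LB), and let $M\in\mathbb N^*$. Then $BMO_{BZ1,M}(\Gamma)=BMO_{BZ2,M}(\Gamma)$, with equivalent norms.
   Context: Graph setting. $\mathbb N=\{0,1,2,\dots\}$, $\mathbb N^*=\mathbb N\setminus\{0\}$. $\Gamma$ is an infinite set and $\mu_{xy}=\mu_{yx}\ge 0$ is a symmetric weight on $\Gamma\times\Gamma$; $x\sim y$ means $\mu_{xy}>0$ ($x\sim x$ is allowed). The graph is connected and locally uniformly finite ($\sup_x\#\{y: y\sim x\}<\infty$). $d$ is the shortest-path distance; $B(x,r)=\{y: d(x,y)<r\}$ for real $r>0$; a ball of radius $\sqrt s$ means a ball given as $B(x,\sqrt s)$ for some $x$; if $B=B(x,r)$ and $\lambda\ge1$, $\lambda B=B(x,\lambda r)$. For a ball $B$, $C_1(B)=4B$ and $C_j(B)=2^{j+1}B\setminus 2^jB$ for $j\ge2$. $m(x)=\sum_{y\sim x}\mu_{xy}$, $m(E)=\sum_{x\in E}m(x)$, $V(x,r)=m(B(x,r))$, $V(B)=m(B)$. $L^p(\Gamma)$ is taken with respect to $m$, and $\|f\|_{L^2(E)}^2=\sum_{x\in E}|f(x)|^2m(x)$. $p(x,y)=\frac{\mu_{xy}}{m(x)m(y)}$, $Pf(x)=\sum_y p(x,y)f(y)m(y)$, $\Delta=I-P$ (nonnegative self-adjoint and injective on $L^2(\Gamma)$). (DV): there is $C>0$ with $V(x,2r)\le C\,V(x,r)$ for all $x\in\Gamma$, $r>0$. (LB):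 there is $\epsilon_{LB}>0$ with $p(x,x)m(x)\ge\epsilon_{LB}$ for all $x\in\Gamma$. BMO spaces. Fix $x_0\in\Gamma$ and $B_0=B(x_0,1)=\{x_0\}$. For $\epsilon>0$, $M\in\mathbb N$, $\mathcal M_0^{M,\epsilon}$ is the space of $\phi\in L^2(\Gamma)$ of the form $\phi=\Delta^M\varphi$ with $\varphi\in L^2(\Gamma)$ and $\|\phi\|_{\mathcal M_0^{M,\epsilon}}:=\sup_{j\ge1}2^{j\epsilon}V(2^jB_0)^{1/2}\|\varphi\|_{L^2(C_j(B_0))}<\infty$. Set $\mathcal E_M=\bigcup_{\epsilon>0}(\mathcal M_0^{M,\epsilon})^*$. For $s\in\mathbb N^*$ let $A$ be $(I-P^{s_1})\cdots(I-P^{s_M})$ with $s_1,\dots,s_M\in\{s,\dots,2s\}$, or $(I-(I+s\Delta)^{-1})^M$. If $\varphi$ is finitely supported then $A\varphi\in\mathcal M_0^{M,\epsilon}$ for all $\epsilon>0$; for $f\in\mathcal E_M$, $Af$ is the function on $\Gamma$ defined by $\sum_x Af(x)\varphi(x)m(x)=\langle f,A\varphi\rangle$ for all finitely supported $\varphi$. $BMO_{BZ1,M}(\Gamma)$ is the set of $f\in\mathcal E_M$ with $\|f\|_{BMO_{BZ1,M}}=\sup\big(\frac1{V(B)}\sum_{x\in B}|(I-P^{s_1})\cdots(I-P^{s_M})f(x)|^2m(x)\big)^{1/2}<\infty$, the supremum being over $s\in\mathbb N^*$, $(s_1,\dots,s_M)\in\{s,\dots,2s\}^M$ and balls $B$ of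 radius $\sqrt s$. $BMO_{BZ2,M}(\Gamma)$ is the set of $f\in\mathcal E_M$ with $\|f\|_{BMO_{BZ2,M}}=\sup\big(\frac1{V(B)}\sum_{x\in B}|(I-(I+s\Delta)^{-1})^Mf(x)|^2m(x)\big)^{1/2}<\infty$, the supremum being over $s\in\mathbb N^*$ and balls $B$ of radius $\sqrt s$. *)

(* Defs.v *)
From HB Require Import structures.
From mathcomp Require Import all_boot all_order all_algebra.
From mathcomp Require Import all_classical all_reals all_analysis.

Set Implicit Arguments.
Unset Strict Implicit.
Unset Printing Implicit Defensive.

Import Order.TTheory GRing.Theory Num.Theory.
Local Open Scope classical_set_scope.
Local Open Scope ring_scope.

Section WeightedGraph.
Context {R : realType} {G : choiceType}.
Implicit Types (mu : G -> G -> R) (f g phi psi : G -> R) (A : (G -> R) -> G -> R).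

Definition adj mu : rel G := fun x y => 0 < mu x y.

Definition walk mu (x y : G) : set (seq G) :=
  [set w | path (adj mu) x w /\ last x w = y].

Definition weighted_graph mu : Prop :=
  [/\ infinite_set [set: G],
      forall x y, mu x y = mu y x,
      forall x y, 0 <= mu x y,
      forall x y, walk mu x y !=set0
    & exists N : nat, forall x, ([set y | adj mu x y] #<= `I_N)%card].

Definition gdist mu (x y : G) : \bar R :=
  ereal_inf [set ((size w)%:R)%:E | w in walk mu x y].

Definition gball mu (x : G) (r : R) : set G :=
  [set y | (gdist mu x y < r%:E)%E].

(* C_j(B) for the ball B = B(x, r) and j >= 1 *)
Definition annulus mu (x : G) (r : R) (j : nat) : set G :=
  if j == 1%N then gball mu x (4 * r)
  else gball mu x (2 ^+ j.+1 * r) `\` gball mu x (2 ^+ j * r).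

Definition mass mu (x : G) : R := \sum_(y \in [set y | adj mu x y]) mu x y.

(* The sums over balls are finite sums, as balls are finite in a locally
   finite graph; [\sum_(x \in E)] would be 0 on a sum of infinite support. *)
Definition vol mu (x : G) (r : R) : R := \sum_(y \in gball mu x r) mass mu y.

Definition transition mu (x y : G) : R := mu x y / (mass mu x * mass mu y).

Definition DV mu : Prop :=
  exists2 C : R, 0 < C &
    forall x r, 0 < r -> vol mu x (2 * r) <= C * vol mu x r.

Definition LB mu : Prop :=
  exists2 eps : R, 0 < eps & forall x, eps <= transition mu x x * mass mu x.

Definition L2norm mu (E : set G) f : \bar R :=
  ((\esum_(x in E) (`|f x| ^+ 2 * mass mu x)%:E) `^ 2^-1)%E.

Definition L2 mu : set (G -> R) := [set f | (L2norm mu setT f < +oo)%E].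

Definition markov_op mu f : G -> R :=
  fun x => \sum_(y \in [set: G]) transition mu x y * f y * mass mu y.

Definition lap mu f : G -> R := f \- markov_op mu f.

(* (I + s Delta)^{-1}, the inverse being that of I + s Delta on L^2 *)
Definition resolvent mu (s : nat) f : G -> R :=
  xget (fun=> 0) [set g | L2 mu g /\ g \+ s%:R \*o lap mu g = f].

(* (I - P^{s_1}) ... (I - P^{s_M}) *)
Definition opBZ1 mu (ss : seq nat) f : G -> R :=
  foldr (fun k g => g \- iter k (markov_op mu) g) f ss.

(* (I - (I + s Delta)^{-1})^M *)
Definition opBZ2 mu (M s : nat) f : G -> R :=
  iter M (fun g => g \- resolvent mu s g) f.

(* The norm in M_0^{M,eps} of phi = Delta^M psi, as a function of psi; psi is
   determined by phi since Delta is injective on L^2. *)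
Definition M0norm mu (x0 : G) (eps : R) psi : \bar R :=
  ereal_sup [set ((2 `^ (j%:R * eps) * Num.sqrt (vol mu x0 (2 ^+ j * 1)))%:E
                  * L2norm mu (annulus mu x0 1 j) psi)%E
            | j in [set j : nat | (1 <= j)%N]].

Definition M0_potential mu (x0 : G) (M : nat) (eps : R) phi psi : Prop :=
  [/\ L2 mu psi, phi = iter M (lap mu) psi & (M0norm mu x0 eps psi < +oo)%E].

Definition M0 mu (x0 : G) (M : nat) (eps : R) : set (G -> R) :=
  [set phi | L2 mu phi /\ exists psi, M0_potential mu x0 M eps phi psi].

(* An element of the dual of M_0^{M,eps} is represented by a function on all of
   G -> R whose values outside M_0^{M,eps} are irrelevant. *)
Definition M0_dual mu (x0 : G) (M : nat) (eps : R) : set ((G -> R) -> R) :=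
  [set F | (forall (a : R) phi phi',
              M0 mu x0 M eps phi -> M0 mu x0 M eps phi' ->
              F (a \*o phi \+ phi') = a * F phi + F phi')
         /\ exists C : R, forall phi psi,
              M0 mu x0 M eps phi -> M0_potential mu x0 M eps phi psi ->
              (`|F phi|%:E <= C%:E * M0norm mu x0 eps psi)%E].

Definition EM mu (x0 : G) (M : nat) : set ((G -> R) -> R) :=
  \bigcup_(eps in [set eps : R | 0 < eps]) M0_dual mu x0 M eps.

Definition finitely_supported f : Prop := finite_set [set x | f x != 0].

(* The function A F on G defined by <A F, phi> = <F, A phi> *)
Definition dual_op mu A (F : (G -> R) -> R) : G -> R :=
  xget (fun=> 0) [set g | forall phi, finitely_supported phi ->
    \sum_(x \in [set: G]) g x * phi x * mass mu x = F (A phi)].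

Definition ball_mean2 mu (x : G) (r : R) f : R :=
  Num.sqrt ((vol mu x r)^-1 *
            \sum_(y \in gball mu x r) `|f y| ^+ 2 * mass mu y).

Definition BMO1_norm mu (M : nat) (F : (G -> R) -> R) : \bar R :=
  ereal_sup [set r | exists (s : nat) (ss : M.-tuple nat) (x : G),
    [/\ (1 <= s)%N, all (fun k => s <= k <= 2 * s)%N ss
      & r = (ball_mean2 mu x (Num.sqrt s%:R)
              (dual_op mu (opBZ1 mu ss) F))%:E]].

Definition BMO2_norm mu (M : nat) (F : (G -> R) -> R) : \bar R :=
  ereal_sup [set r | exists (s : nat) (x : G),
    (1 <= s)%N /\
    r = (ball_mean2 mu x (Num.sqrt s%:R) (dual_op mu (opBZ2 mu M s) F))%:E].

Definition BMO1 mu (x0 : G) (M : nat) : set ((G -> R) -> R) :=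
  [set F | EM mu x0 M F /\ (BMO1_norm mu M F < +oo)%E].

Definition BMO2 mu (x0 : G) (M : nat) : set ((G -> R) -> R) :=
  [set F | EM mu x0 M F /\ (BMO2_norm mu M F < +oo)%E].

End WeightedGraph.

(* Main.v *)
Require Import Defs.
From HB Require Import structures.
From mathcomp Require Import all_boot all_order all_algebra finmap.
From mathcomp Require Import all_classical all_reals all_analysis.
From mathcomp Require Import ring lra zify.

Set Implicit Arguments.
Unset Strict Implicit.
Unset Printing Implicit Defensive.

Import Order.TTheory GRing.Theory Num.Theory.
Import numFieldNormedType.Exports.
Local Open Scope classical_set_scope.
Local Open Scope ring_scope.

(** Let [R = (I + s Delta)^-1]; it is the average of the powers [P ^ n] over a
    geometric law of mean [s].  Both operators defining the two BMO spaces are compared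
    through identities that only involve powers of [P].

    - [I - P ^ k = (I - R) T_k] with [T_k = I - P ^ k + s^-1 (I + ... + P ^ (k - 1))],
      a polynomial in [P] which is bounded in [L^2] with exponential weights at scale
      [sqrt s], uniformly in [s] for [k <= 2 s].

    - [I - R] is the average of [I - P ^ n], and each [I - P ^ n] is a combination of at
      most [n / s + 2] operators [P ^ i (I - P ^ k)] with [s <= k <= 2 s]: for [n < s]
      one uses [I - P ^ n = (I - P ^ (s + n)) - P ^ n (I - P ^ s)].

    Laziness gives the second order bound [|P f|_w <= (1 + O(1 / s)) |f|_w] for the
    weights [w = exp (kappa d(z, .) / sqrt s)], so that the powers [P ^ n] grow like
    [exp (n / (8 s))] only, which the geometric law absorbs.  By duality the [L^2] norm
    of [A_1 f] on a ball is then a pairing of [A_2 f] with a function in the weighted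
    [L^2], and conversely; volume doubling turns the bounds on balls of radius [sqrt s]
    into a bound in the dual weighted [L^2]. *)

(** * Finite sums: Cauchy-Schwarz and a lower bound for the variance *)

Section FiniteSums.
Context {R : realType}.

(** Lagrange's identity: the double sum of [c i * c j * (a i * b j - a j * b i) ^+ 2] is twice the
    gap between the two sides. *)
Lemma weighted_cauchy_schwarz (I : Type) (r : seq I) (c a b : I -> R) :
  (forall i, 0 <= c i) ->
  (\sum_(i <- r) c i * a i * b i) ^+ 2 <=
  (\sum_(i <- r) c i * a i ^+ 2) * (\sum_(i <- r) c i * b i ^+ 2).
Proof.
move=> c0; set X := \sum_(i <- r) _; set A := \sum_(i <- r) _; set B := \sum_(i <- r) _.
have : 0 <= \sum_(i <- r) \sum_(j <- r) c i * c j * (a i * b j - a j * b i) ^+ 2.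
  by apply: sumr_ge0 => i _; apply: sumr_ge0 => j _; rewrite mulr_ge0 ?sqr_ge0// mulr_ge0.
have -> : \sum_(i <- r) \sum_(j <- r) c i * c j * (a i * b j - a j * b i) ^+ 2 =
    2 * (A * B - X ^+ 2).
  have AB : A * B = \sum_(i <- r) \sum_(j <- r) c i * a i ^+ 2 * (c j * b j ^+ 2).
    by rewrite big_distrlr.
  have BA : A * B = \sum_(i <- r) \sum_(j <- r) c j * a j ^+ 2 * (c i * b i ^+ 2).
    by rewrite AB exchange_big.
  have XX : X ^+ 2 = \sum_(i <- r) \sum_(j <- r) c i * a i * b i * (c j * a j * b j).
    by rewrite expr2 big_distrlr.
  have -> : 2 * (A * B - X ^+ 2) = A * B + A * B - 2 * X ^+ 2 by ring.
  rewrite {1}AB BA XX mulr_sumr -big_split -sumrB; apply: eq_bigr => i _ /=.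
  rewrite mulr_sumr -big_split -sumrB; apply: eq_bigr => j _ /=; ring.
by lra.
Qed.

(** Deviations are measured from [f x]. For total mass one the variance is [D - X ^+ 2], and
    Cauchy-Schwarz over the remaining points gives [X ^+ 2 <= P * D], which leaves at least
    [p x * D]. *)
Lemma variance_ge (G : eqType) (r : seq G) (p f : G -> R) (e : R) (x : G) :
  (forall y, 0 <= p y) -> \sum_(y <- r) p y <= 1 -> x \in r -> e <= p x ->
  (\sum_(y <- r) p y * f y) ^+ 2 + e * \sum_(y <- r) p y * (f y - f x) ^+ 2 <=
  \sum_(y <- r) p y * f y ^+ 2.
Proof.
move=> p0 p1 xr ep; set a := f x.
pose P := \sum_(y <- rem x r) p y; pose X := \sum_(y <- rem x r) p y * (f y - a).
pose D := \sum_(y <- rem x r) p y * (f y - a) ^+ 2.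
have sP : \sum_(y <- r) p y = p x + P by rewrite (big_rem x).
have sX : \sum_(y <- r) p y * f y = X + a * (p x + P).
  rewrite (big_rem x)//= -/a mulrDr addrCA mulrC; congr (_ + _).
  rewrite /X /P mulr_sumr -big_split; apply: eq_bigr => y _ /=; ring.
have sD : \sum_(y <- r) p y * (f y - a) ^+ 2 = D.
  by rewrite (big_rem x)//= subrr expr0n mulr0 add0r.
have sF : \sum_(y <- r) p y * f y ^+ 2 = D + 2 * a * X + a ^+ 2 * (p x + P).
  rewrite (big_rem x)//= -/a mulrDr addrCA mulrC; congr (_ + _).
  rewrite /X /P /D !mulr_sumr -!big_split; apply: eq_bigr => y _ /=; ring.
have P0 : 0 <= P by apply: sumr_ge0.
have D0 : 0 <= D by apply: sumr_ge0 => y _; rewrite mulr_ge0 ?sqr_ge0.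
have XPD : X ^+ 2 <= P * D.
  have := @weighted_cauchy_schwarz _ (rem x r) p (fun=> 1) (fun y => f y - a) p0.
  congr (_ ^+ 2 <= _ * _); apply: eq_bigr => y _; ring.
have aXD : 0 <= D + 2 * a * X + a ^+ 2 * P.
  have -> : D + 2 * a * X + a ^+ 2 * P = \sum_(y <- rem x r) p y * f y ^+ 2.
    rewrite /X /P /D !mulr_sumr -!big_split; apply: eq_bigr => y _ /=; ring.
  by apply: sumr_ge0 => y _; rewrite mulr_ge0 ?sqr_ge0.
rewrite sX sD sF; rewrite sP in p1.
have q0 : 0 <= 1 - (p x + P) by rewrite subr_ge0.
have qa := mulr_ge0 q0 aXD.
have pD : 0 <= (p x - e) * D by rewrite mulr_ge0 ?subr_ge0.
have pq : 0 <= p x * (a ^+ 2 * (1 - (p x + P))) by rewrite mulr_ge0// mulr_ge0// sqr_ge0.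
(* The gap is the sum of [P * D - X ^+ 2] and of the three products in [qa], [pD] and [pq]; [qa] and
   [pq] account for the missing mass. *)
nra.
Qed.

End FiniteSums.

(** * One weighted step of the random walk on a finite set *)

Section FiniteMaximumPrinciple.
Context {R : realType} {G : eqType}.
Variables (mu : G -> G -> R) (m : G -> R) (eps : R) (r : seq G).
Hypotheses (mu_sym : forall x y, mu x y = mu y x) (mu_ge0 : forall x y, 0 <= mu x y).
Hypotheses (m_gt0 : forall x, 0 < m x) (mu_le : forall x, \sum_(y <- r) mu x y <= m x).
Hypotheses (eps_gt0 : 0 < eps) (eps_le : forall x, eps * m x <= mu x x).

Lemma sqr_average_le (f : G -> R) x : x \in r ->
  ((\sum_(y <- r) mu x y * f y) / m x) ^+ 2 * m x <=
  \sum_(y <- r) mu x y * f y ^+ 2 - eps * \sum_(y <- r) mu x y * (f y - f x) ^+ 2.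
Proof.
move=> xr; have mx := m_gt0 x; have mx0 : m x != 0 by rewrite gt_eqF.
have := @variance_ge _ _ r (fun y => mu x y / m x) f eps x.
have sm (F : G -> R) : \sum_(y <- r) mu x y / m x * F y = (\sum_(y <- r) mu x y * F y) / m x.
  by rewrite mulr_suml; apply: eq_bigr => y _; rewrite mulrAC.
rewrite !sm => /(_ _ _ xr) V.
set S := \sum_(y <- r) mu x y * f y; set T := \sum_(y <- r) mu x y * f y ^+ 2.
set D := \sum_(y <- r) mu x y * (f y - f x) ^+ 2.
rewrite -ler_pdivlMr// mulrBl -mulrA lerBrDr; apply: V.
- by move=> y; rewrite divr_ge0// ltW.
- by rewrite -mulr_suml ler_pdivrMr// mul1r.
- by rewrite ler_pdivlMr.
Qed.

(* Exploiting the variance absorbs the gradient of [f], so that a weight with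
   relative variation [eta] along the edges costs only a factor [1 + O(eta ^+ 2)]. *)
Lemma finite_maximum_principle (w f : G -> R) (eta : R) :
  (forall x, 0 <= w x) -> 0 <= eta <= 1 ->
  (forall x y, 0 < mu x y -> `|w y - w x| <= eta * w x) ->
  \sum_(x <- r) w x * ((\sum_(y <- r) mu x y * f y) / m x) ^+ 2 * m x <=
  (1 + 3 / (8 * eps) * eta ^+ 2) * \sum_(x <- r) w x * f x ^+ 2 * m x.
Proof.
move=> w0 /andP[eta0 eta1] weta.
pose A := \sum_(x <- r) \sum_(y <- r) w x * mu x y * f y ^+ 2.
pose B := \sum_(x <- r) \sum_(y <- r) w x * mu x y * f x ^+ 2.
pose D := \sum_(x <- r) \sum_(y <- r) w x * mu x y * (f y - f x) ^+ 2.
set N := \sum_(x <- r) w x * f x ^+ 2 * m x.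
have A' : A = \sum_(x <- r) \sum_(y <- r) w y * mu x y * f x ^+ 2.
  by rewrite /A exchange_big; do 2!apply: eq_bigr => ? _; rewrite mu_sym.
have B' : B = \sum_(x <- r) \sum_(y <- r) w y * mu x y * f y ^+ 2.
  by rewrite /B exchange_big; do 2!apply: eq_bigr => ? _; rewrite mu_sym.
have BN : B <= N.
  apply: ler_sum => x _; rewrite -mulr_suml -mulr_sumr -mulrA -[in leRHS]mulrA.
  by rewrite ler_wpM2l// mulrC ler_wpM2l ?sqr_ge0.
(* As [eta <= 1], neighbouring weights satisfy [w y <= 2 * w x]. *)
have AB : A <= 2 * N.
  apply: (@le_trans _ _ (2 * B)); last by rewrite ler_pM2l.
  rewrite A' /B mulr_sumr; apply: ler_sum => x _.
  rewrite mulr_sumr; apply: ler_sum => y _; rewrite mulrA ler_wpM2r ?sqr_ge0// mulrA.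
  have := mu_ge0 x y; rewrite le_eqVlt => /predU1P[<-|muxy]; first by rewrite !mulr0.
  rewrite ler_pM2r//; have := weta _ _ muxy; rewrite ler_norml => /andP[_].
  have := w0 x; nra.
have LA : \sum_(x <- r) w x * ((\sum_(y <- r) mu x y * f y) / m x) ^+ 2 * m x <= A - eps * D.
  rewrite /A /D mulr_sumr -sumrB big_seq [leRHS]big_seq; apply: ler_sum => x xr.
  rewrite -mulrA; apply: le_trans (_ : w x * (\sum_(y <- r) mu x y * f y ^+ 2 -
     eps * \sum_(y <- r) mu x y * (f y - f x) ^+ 2) <= _).
    by rewrite ler_wpM2l// sqr_average_le.
  rewrite mulrBr le_eqVlt; apply/predU1P; left; congr (_ - _); rewrite !mulr_sumr.
    by apply: eq_bigr => y _; rewrite mulrA.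
  by apply: eq_bigr => y _; rewrite mulrCA !mulrA.
(* By the symmetrised forms, [2 * A - 2 * B] is the sum of [mu x y * (w x - w y) * (f y ^+ 2 - f x
   ^+ 2)]. Young's inequality splits each term so that the gradient part is [2 * eps * D], which the
   variance gain in [LA] cancels. *)
have AB2 : 2 * A - 2 * B <= 2 * eps * D + eta ^+ 2 / (4 * eps) * (A + B).
  have -> : 2 * A - 2 * B = (A + A) - (B + B) by ring.
  rewrite {1}A' {2}B' /A /B /D -!big_split !mulr_sumr -sumrB -big_split; apply: ler_sum => x _ /=.
  rewrite -!big_split !mulr_sumr -sumrB -big_split; apply: ler_sum => y _ /=.
  have := mu_ge0 x y; rewrite le_eqVlt => /predU1P[<-|muxy]; first by rewrite !(mulr0, mul0r, addr0, subr0).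
  have := weta _ _ muxy; rewrite ler_norml => /andP[h1 h2].
  set u := w x in h1 h2 *; set v := w y in h1 h2 *; set c := mu x y.
  have u0 : 0 <= u := w0 x.
  set a := f x; set b := f y.
  have K : (u - v) * (b ^+ 2 - a ^+ 2) <= u * (2 * eps * (b - a) ^+ 2 + eta ^+ 2 / (8 * eps) * (b + a) ^+ 2).
    have sq : 0 <= (2 * eps) * (b - a) ^+ 2 + eta ^+ 2 / (8 * eps) * (b + a) ^+ 2 - eta * `|b - a| * `|b + a|.
      have -> : (2 * eps) * (b - a) ^+ 2 + eta ^+ 2 / (8 * eps) * (b + a) ^+ 2 - eta * `|b - a| * `|b + a|
        = 2 * eps * (`|b - a| - eta / (4 * eps) * `|b + a|) ^+ 2.
        rewrite -(real_normK (num_real (b - a))) -(real_normK (num_real (b + a))).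
        by field; rewrite gt_eqF.
      by rewrite mulr_ge0 ?sqr_ge0// mulr_ge0// ltW.
    have -> : (u - v) * (b ^+ 2 - a ^+ 2) = (u - v) * (b - a) * (b + a) by ring.
    apply: le_trans (ler_norm _) _; rewrite !normrM.
    apply: le_trans (_ : eta * u * `|b - a| * `|b + a| <= _).
      by rewrite ler_wpM2r// ler_wpM2r// distrC weta.
    by nra.
  have K2 : u * (eta ^+ 2 / (8 * eps) * (b + a) ^+ 2) <= u * (eta ^+ 2 / (4 * eps) * (b ^+ 2 + a ^+ 2)).
    rewrite ler_wpM2l//.
    have -> : eta ^+ 2 / (4 * eps) * (b ^+ 2 + a ^+ 2) = eta ^+ 2 / (8 * eps) * (2 * (b ^+ 2 + a ^+ 2)).
      by field; rewrite gt_eqF.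
    rewrite ler_wpM2l//; last by have := sqr_ge0 (b - a); lra.
    by rewrite divr_ge0 ?sqr_ge0// mulr_ge0// ltW.
  have := ler_wpM2l (mu_ge0 x y) (le_trans K (_ : _ <= u * (2 * eps * (b - a) ^+ 2 + eta ^+ 2 / (4 * eps) * (b ^+ 2 + a ^+ 2)))).
  rewrite -/c mulrDr (mulrDr u (2 * eps * (b - a) ^+ 2)) lerD2l => /(_ K2).
  congr (_ <= _); ring.
have e4 : 0 <= eta ^+ 2 / (8 * eps) by rewrite divr_ge0 ?sqr_ge0// mulr_ge0// ltW.
have -> : 3 / (8 * eps) * eta ^+ 2 = 3 * (eta ^+ 2 / (8 * eps)) by ring.
have E4 : eta ^+ 2 / (4 * eps) = 2 * (eta ^+ 2 / (8 * eps)) by field; rewrite gt_eqF.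
rewrite E4 in AB2; apply: le_trans LA _.
have : (eta ^+ 2 / (8 * eps)) * (A + B) <= (eta ^+ 2 / (8 * eps)) * (3 * N).
  by rewrite ler_wpM2l//; lra.
by lra.
Qed.

End FiniteMaximumPrinciple.

(** * Sums over duplicate-free lists *)

Section UniqSums.
Context {R : numDomainType} {G : eqType}.

Lemma sum_uniq_restrict (V : nmodType) (E E' : seq G) (F : G -> V) :
  uniq E -> uniq E' -> {subset E <= E'} ->
  \sum_(x <- E) F x = \sum_(x <- E' | x \in E) F x.
Proof.
move=> uE uE' sE; rewrite -[RHS]big_filter; apply: perm_big.
apply: uniq_perm => //; first exact: filter_uniq.
by move=> x; rewrite mem_filter; case: (boolP (x \in E)) => // /sE ->.
Qed.

Lemma ler_sum_uniq_sub (E E' : seq G) (F : G -> R) :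
  uniq E -> uniq E' -> {subset E <= E'} -> (forall x, 0 <= F x) ->
  \sum_(x <- E) F x <= \sum_(x <- E') F x.
Proof.
move=> uE uE' sE F0; rewrite (sum_uniq_restrict _ uE uE' sE).
by rewrite [leRHS](bigID (fun x => x \in E))/= lerDl sumr_ge0.
Qed.

Lemma sum_uniq_widen (V : nmodType) (E E' : seq G) (F : G -> V) :
  uniq E -> uniq E' -> {subset E <= E'} -> (forall x, x \notin E -> F x = 0) ->
  \sum_(x <- E') F x = \sum_(x <- E) F x.
Proof.
move=> uE uE' sE F0; rewrite (sum_uniq_restrict _ uE uE' sE).
by rewrite [LHS](bigID (fun x => x \in E))/= [X in _ + X]big1 ?addr0.
Qed.

End UniqSums.

(** * Weighted square norms, tested on finite lists *)

Section WeightedNorm.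
Context {R : realType} {G : choiceType}.
Variable m : G -> R.
Hypothesis m_gt0 : forall x, 0 < m x.
Implicit Types (w f g : G -> R) (K L c : R).

(* The norm of [f] in [L^2(w m)] is at most [K]. *)
Definition wle w f K :=
  0 <= K /\ forall E : seq G, uniq E -> \sum_(x <- E) w x * f x ^+ 2 * m x <= K ^+ 2.

Lemma wle_le w f K L : K <= L -> wle w f K -> wle w f L.
Proof.
move=> KL [K0 fK]; split; first exact: le_trans KL.
by move=> E uE; apply: le_trans (fK E uE) _; rewrite ler_pXn2r ?nnegrE// (le_trans K0).
Qed.

Lemma wle0 w : wle w (fun=> 0) 0.
Proof. by split=> // E _; rewrite big1 => [|x _]; rewrite expr0n/= ?mulr0 ?mul0r. Qed.

Lemma wleZ w f K c : wle w f K -> wle w (c \*o f) (`|c| * K).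
Proof.
move=> [K0 fK]; split; first by rewrite mulr_ge0.
move=> E uE; rewrite exprMn real_normK ?num_real//.
apply: le_trans (ler_wpM2l (sqr_ge0 c) (fK E uE)).
by rewrite mulr_sumr le_eqVlt; apply/predU1P; left; apply: eq_bigr => x _ /=; ring.
Qed.

(** Minkowski's inequality: Cauchy-Schwarz bounds the cross term [X] by [K * L] on every finite
    list. *)
Lemma wleD w f g K L : (forall x, 0 <= w x) ->
  wle w f K -> wle w g L -> wle w (f \+ g) (K + L).
Proof.
move=> w0 [K0 fK] [L0 gL]; split; first by rewrite addr_ge0.
move=> E uE; have {}fK := fK E uE; have {}gL := gL E uE.
pose X := \sum_(x <- E) w x * m x * f x * g x.
have wm0 x : 0 <= w x * m x by rewrite mulr_ge0// ltW.
have eqs h : \sum_(x <- E) w x * h x ^+ 2 * m x = \sum_(x <- E) w x * m x * h x ^+ 2.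
  by apply: eq_bigr => x _; rewrite mulrAC.
have XKL : X <= K * L.
  have : X ^+ 2 <= (K * L) ^+ 2.
    rewrite exprMn; apply: le_trans (weighted_cauchy_schwarz _ _ _ wm0) _.
    by rewrite -!eqs ler_pM// sumr_ge0// => x _; rewrite mulrAC mulr_ge0// sqr_ge0.
  have KL0 : 0 <= K * L by rewrite mulr_ge0.
  rewrite -ler_sqrt ?sqr_ge0// !sqrtr_sqr (ger0_norm KL0); apply: le_trans.
  exact: ler_norm.
have -> : \sum_(x <- E) w x * (f \+ g) x ^+ 2 * m x =
    \sum_(x <- E) w x * f x ^+ 2 * m x + 2 * X + \sum_(x <- E) w x * g x ^+ 2 * m x.
  rewrite /X mulr_sumr -!big_split; apply: eq_bigr => x _ /=; ring.
have -> : (K + L) ^+ 2 = K ^+ 2 + 2 * (K * L) + L ^+ 2 by ring.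
by lra.
Qed.

Lemma wle_sum w (I : Type) (r : seq I) (f : I -> G -> R) (K : I -> R) :
  (forall x, 0 <= w x) -> (forall i, wle w (f i) (K i)) ->
  wle w (fun x => \sum_(i <- r) f i x) (\sum_(i <- r) K i).
Proof.
move=> w0 fK; elim: r => [|i r ih].
  by rewrite big_nil; under eq_fun do rewrite big_nil; exact: wle0.
by rewrite big_cons; under eq_fun do rewrite big_cons; exact: wleD.
Qed.

Lemma wle_weight w w' f K : (forall x, w' x <= w x) -> wle w f K -> wle w' f K.
Proof.
move=> ww [K0 fK]; split=> // E uE; apply: le_trans (fK E uE).
by apply: ler_sum => x _; apply: ler_wpM2r; [exact: ltW | apply: ler_wpM2r; rewrite ?sqr_ge0].
Qed.

Lemma wle_pointwise w f K x : 0 < w x -> wle w f K -> `|f x| <= K / Num.sqrt (w x * m x).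
Proof.
move=> wx [K0 /(_ [:: x] isT)]; rewrite big_seq1 => fK.
have wm : 0 < w x * m x by rewrite mulr_gt0.
rewrite ler_pdivlMr ?sqrtr_gt0// -(ler_pXn2r (_ : (0 < 2)%N)) ?nnegrE ?mulr_ge0//.
rewrite exprMn sqr_sqrtr; last exact: ltW.
by rewrite real_normK ?num_real//; apply: le_trans fK; rewrite mulrA (mulrC (f x ^+ 2)).
Qed.

(** Each test involves finitely many points, so pointwise convergence passes the bound to the
    limit. *)
Lemma wle_cvg w (f : nat -> G -> R) g K :
  (forall n, wle w (f n) K) -> (forall x, f n x @[n --> \oo] --> g x) -> wle w g K.
Proof.
move=> fK fg; split; first by case: (fK 0%N).
move=> E uE.
have lim : \sum_(x <- E) w x * f n x ^+ 2 * m x @[n --> \oo] --> \sum_(x <- E) w x * g x ^+ 2 * m x.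
  elim: (E) => [|x E' ih].
    by rewrite big_nil; under eq_fun do rewrite big_nil; exact: cvg_cst.
  rewrite big_cons; under eq_fun do rewrite big_cons.
  apply: cvgD => //; apply: cvgMr_tmp; apply: cvgMl_tmp; rewrite expr2.
  by under eq_fun do rewrite expr2; apply: cvgM.
rewrite -(cvg_lim _ lim)//; apply: limr_le; first by apply: cvgP lim.
by near=> n; exact: (fK n).2.
Unshelve. all: by end_near. Qed.

Lemma wle_supp w f (E : seq G) : (forall x, 0 <= w x) -> uniq E ->
  (forall x, f x != 0 -> x \in E) ->
  wle w f (Num.sqrt (\sum_(x <- E) w x * f x ^+ 2 * m x)).
Proof.
move=> w0 uE fE.
have t0 x : 0 <= w x * f x ^+ 2 * m x.
  by apply: mulr_ge0 (ltW _) => //; exact: mulr_ge0 (w0 x) (sqr_ge0 _).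
split=> [|E' uE']; first exact: sqrtr_ge0.
rewrite sqr_sqrtr ?sumr_ge0//; pose H := undup (E' ++ E).
have uH : uniq H by rewrite undup_uniq.
apply: (@le_trans _ _ (\sum_(x <- H) w x * f x ^+ 2 * m x)).
  by apply: ler_sum_uniq_sub => // x xE; rewrite mem_undup mem_cat xE.
rewrite (@sum_uniq_widen _ _ E)//; first by move=> x xE; rewrite mem_undup mem_cat xE orbT.
by move=> x xE; rewrite (_ : f x = 0) ?expr0n ?mulr0 ?mul0r//; apply: contraNeq xE => /fE.
Qed.

End WeightedNorm.

(** * Mass, laziness and the Markov operator *)

Section WeightedGraphs.
Context {R : realType} {G : choiceType}.
Variable mu : G -> G -> R.
Hypothesis graph_mu : weighted_graph mu.

Let mu_sym x y : mu x y = mu y x. Proof. by have [_ + _ _ _] := graph_mu; apply. Qed.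
Let mu_ge0 x y : 0 <= mu x y. Proof. by have [_ _ + _ _] := graph_mu; apply. Qed.

Lemma finite_adj x : finite_set [set y | adj mu x y].
Proof.
have [_ _ _ _ [N /(_ x) xN]] := graph_mu.
exact: card_le_finite xN (finite_II N).
Qed.

Definition nbrs x : seq G := enum_fset (fset_set [set y | adj mu x y]).

Lemma mem_nbrs x y : (y \in nbrs x) = adj mu x y.
Proof. by rewrite in_fset_set ?inE//=; [apply/idP/idP; rewrite inE | exact: finite_adj]. Qed.

Lemma mu_eq0 x y : y \notin nbrs x -> mu x y = 0.
Proof. by rewrite mem_nbrs /adj -leNgt => muxy; apply/eqP; rewrite eq_le muxy mu_ge0. Qed.

Lemma massE x (E : seq G) : uniq E -> {subset nbrs x <= E} ->
  mass mu x = \sum_(y <- E) mu x y.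
Proof.
move=> uE sE; rewrite /mass fsbig_finite /=; last exact: finite_adj.
by symmetry; apply: sum_uniq_widen => // y; exact: mu_eq0.
Qed.

Lemma mass_ge x (E : seq G) : uniq E -> \sum_(y <- E) mu x y <= mass mu x.
Proof.
move=> uE; pose E' := undup (E ++ nbrs x).
rewrite (@massE x E') ?undup_uniq//; last by move=> y yx; rewrite mem_undup mem_cat yx orbT.
by apply: ler_sum_uniq_sub; rewrite ?undup_uniq// => y yE; rewrite mem_undup mem_cat yE.
Qed.

Lemma mass_ge0 x : 0 <= mass mu x.
Proof. by apply: le_trans (@mass_ge x [::] isT); rewrite big_nil. Qed.

Lemma adj_sym x y : adj mu x y = adj mu y x. Proof. by rewrite /adj mu_sym. Qed.

Variable eps : R.
Hypotheses (eps_gt0 : 0 < eps) (lazy : forall x, eps <= transition mu x x * mass mu x).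

Lemma mass_gt0 x : 0 < mass mu x.
Proof.
rewrite lt_neqAle mass_ge0 andbT eq_sym; apply/eqP => m0.
by have := lazy x; rewrite m0 mulr0 leNgt eps_gt0.
Qed.

Lemma lazy_mu x : eps * mass mu x <= mu x x.
Proof.
have mx := mass_gt0 x; rewrite -ler_pdivlMr//; apply: le_trans (lazy x) _.
by rewrite /transition invfM mulrA mulfVK ?gt_eqF.
Qed.

Lemma eps_le1 : forall x : G, eps <= 1.
Proof.
move=> x; rewrite -(ler_pM2r (mass_gt0 x)) mul1r; apply: le_trans (lazy_mu x) _.
by have := @mass_ge x [:: x] isT; rewrite big_seq1.
Qed.

(** Any list containing the neighbours will do, so that a single list can serve all points of a
    finite set, as [wle_markov] requires. *)
Lemma markovE f x (E : seq G) : uniq E -> {subset nbrs x <= E} ->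
  markov_op mu f x = (\sum_(y <- E) mu x y * f y) / mass mu x.
Proof.
move=> uE sE; rewrite /markov_op mulr_suml.
have h y : transition mu x y * f y * mass mu y = mu x y * f y / mass mu x.
  rewrite /transition; field; rewrite !gt_eqF ?mass_gt0//.
under eq_fsbigr do rewrite h.
rewrite (fsbigE E)//=; first by apply: eq_bigl => y; rewrite in_setT.
by move=> y _ yE; rewrite mu_eq0 ?mul0r//; apply: contra yE; exact: sE.
Qed.

Lemma markov_nbrs f x : markov_op mu f x = (\sum_(y <- nbrs x) mu x y * f y) / mass mu x.
Proof. by apply: markovE => //; exact: fset_uniq. Qed.

Lemma markovD f g : markov_op mu (f \+ g) = markov_op mu f \+ markov_op mu g.
Proof.
apply/funext => x /=; rewrite !markov_nbrs -mulrDl -big_split; congr (_ / _).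
by apply: eq_bigr => y _; rewrite mulrDr.
Qed.

Lemma markovZ c f : markov_op mu (c \*o f) = c \*o markov_op mu f.
Proof.
apply/funext => x /=; rewrite !markov_nbrs mulrA mulr_sumr; congr (_ / _).
by apply: eq_bigr => y _; rewrite mulrCA.
Qed.

Lemma markov_cvg (f : nat -> G -> R) g :
  (forall x, f n x @[n --> \oo] --> g x) ->
  forall x, markov_op mu (f n) x @[n --> \oo] --> markov_op mu g x.
Proof.
move=> fg x; rewrite markov_nbrs; under eq_fun do rewrite markov_nbrs.
apply: cvgMr_tmp; elim: (nbrs x) => [|y r ih].
  by rewrite big_nil; under eq_fun do rewrite big_nil; exact: cvg_cst.
rewrite big_cons; under eq_fun do rewrite big_cons.
by apply: cvgD => //; apply: cvgMl_tmp; exact: fg.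
Qed.

Lemma wle_markov w f (K eta rho : R) :
  (forall x, 0 <= w x) -> 0 <= eta <= 1 -> 0 <= rho ->
  (forall x y, adj mu x y -> `|w y - w x| <= eta * w x) ->
  1 + 3 / (8 * eps) * eta ^+ 2 <= rho ^+ 2 ->
  wle (mass mu) w f K -> wle (mass mu) w (markov_op mu f) (rho * K).
Proof.
move=> w0 eta01 rho0 weta etarho [K0 fK]; split; first exact: mulr_ge0.
(* [E'] contains the neighbours of all points of [E], so on [E] the truncated average over [E'] is
   [markov_op mu f]; the remaining points of [E'] only add nonnegative terms. *)
move=> E uE; pose E' := undup (E ++ flatten (map nbrs E)).
have uE' : uniq E' by rewrite undup_uniq.
have sE : {subset E <= E'} by move=> x xE; rewrite mem_undup mem_cat xE.
have t0 (g : G -> R) x : 0 <= w x * g x ^+ 2 * mass mu x.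
  by rewrite mulr_ge0 ?mass_ge0// mulr_ge0 ?sqr_ge0.
apply: (@le_trans _ _ (\sum_(x <- E) w x *
    ((\sum_(y <- E') mu x y * f y) / mass mu x) ^+ 2 * mass mu x)).
  rewrite big_seq [leRHS]big_seq; apply: ler_sum => x xE; rewrite (markovE _ uE')//.
  move=> y yx; rewrite mem_undup mem_cat; apply/orP; right; apply/flattenP.
  by exists (nbrs x) => //; exact: map_f.
apply: le_trans (ler_sum_uniq_sub uE uE' sE (t0 _)) _.
have := @finite_maximum_principle _ _ mu (mass mu) eps E' mu_sym mu_ge0 mass_gt0
  (fun x => mass_ge x uE') eps_gt0 lazy_mu w f eta w0 eta01 weta.
move/le_trans; apply; rewrite exprMn ler_pM ?sumr_ge0 ?fK//.
by rewrite addr_ge0// mulr_ge0 ?sqr_ge0// divr_ge0// mulr_ge0// ltW.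
Qed.

Lemma wle_markov_contract f K :
  wle (mass mu) (fun=> 1) f K -> wle (mass mu) (fun=> 1) (markov_op mu f) K.
Proof.
move=> fK; rewrite -(mul1r K); apply: (@wle_markov _ _ _ 0) fK; rewrite ?lexx ?ler01//.
- by move=> x y _; rewrite subrr normr0 mul0r.
- by rewrite expr0n mulr0 addr0 expr1n.
Qed.

(** * Graph distance, balls and volumes *)

Definition dist x y : R := fine (gdist mu x y).

(** Walk lengths are natural numbers, so the infimum over the nonempty set of walks is a minimum. *)
Lemma gdist_attained x y : exists2 w, walk mu x y w & gdist mu x y = (size w)%:R%:E.
Proof.
have exn : exists n, `[< exists2 w, walk mu x y w & size w = n >].
  have [_ _ _ /(_ x y)[w xyw] _] := graph_mu.
  by exists (size w); apply/asboolP; exists w.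
case: (ex_minnP exn) => n /asboolP[w xyw sw] nmin; exists w => //; apply/eqP; rewrite eq_le.
apply/andP; split; first by apply: ereal_inf_lbound; exists w.
apply: le_ereal_inf_tmp => _ [w' xyw' <-]; rewrite lee_fin ler_nat sw; apply: nmin.
by apply/asboolP; exists w'.
Qed.

Lemma gdistE x y : gdist mu x y = (dist x y)%:E.
Proof. by rewrite /dist; have [w _ ->] := gdist_attained x y. Qed.

Lemma dist_walk x y : exists2 w, walk mu x y w & dist x y = (size w)%:R.
Proof. by have [w xyw] := gdist_attained x y; rewrite gdistE => -[->]; exists w. Qed.

Lemma dist_le x y w : walk mu x y w -> dist x y <= (size w)%:R.
Proof. by move=> xyw; rewrite -lee_fin -gdistE; apply: ereal_inf_lbound; exists w. Qed.

Lemma gballE x r y : gball mu x r y <-> dist x y < r.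
Proof. by rewrite /gball/= gdistE lte_fin. Qed.

Lemma dist_ge0 x y : 0 <= dist x y.
Proof. by have [w _ ->] := dist_walk x y. Qed.

Lemma dist_refl x : dist x x = 0.
Proof. by apply/eqP; rewrite eq_le dist_ge0 andbT; exact: (@dist_le x x [::]). Qed.

Lemma dist_triangle x y z : dist x z <= dist x y + dist y z.
Proof.
have [w [xw wy] ->] := dist_walk x y; have [w' [yw' w'z] ->] := dist_walk y z.
rewrite -natrD -size_cat; apply: dist_le; split.
  by rewrite cat_path xw wy.
by rewrite last_cat wy.
Qed.

Lemma dist_adj x y : adj mu x y -> dist x y <= 1.
Proof. by move=> xy; apply: (@dist_le x y [:: y]); split; rewrite //= xy. Qed.

Lemma dist_sym x y : dist x y = dist y x.
Proof.
suff h a b : dist a b <= dist b a by apply/eqP; rewrite eq_le !h.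
have [w [bw wa] ->] := dist_walk b a.
rewrite -(size_belast b) -size_rev; apply: dist_le; split.
  rewrite -wa rev_path; apply: sub_path bw => u v.
  by rewrite adj_sym.
rewrite -(last_cons b) -rev_rcons; case: w bw wa => [|c w] /=; first by move=> _ <-.
by rewrite rev_cons last_rcons.
Qed.

Lemma finite_walk_targets x n :
  finite_set [set y | exists2 w, walk mu x y w & (size w <= n)%N].
Proof.
elim: n => [|n ih].
  apply: (@sub_finite_set _ _ [set x]); last exact: finite_set1.
  by move=> y [w [_ <-]]; rewrite leqn0 size_eq0 => /eqP ->.
set A := [set y | _] in ih.
apply: (@sub_finite_set _ _ (A `|` \bigcup_(z in A) [set y | adj mu z y])); last first.
  rewrite finite_setU; split=> //; apply: bigcup_finite => // z _; exact: finite_adj.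
move=> y [w]; case: (lastP w) => [|w' u] [xw].
  by move=> yx _; left; exists [::].
rewrite last_rcons => <-; rewrite size_rcons ltnS => sw.
move: xw; rewrite rcons_path => /andP[xw' wy].
by right; exists (last x w') => //; exists w'.
Qed.

Lemma finite_gball x r : finite_set (gball mu x r).
Proof.
have [N rN] : exists N : nat, r <= N%:R.
  by exists (Num.trunc r).+1; rewrite ltW// truncnS_gt.
apply: sub_finite_set (finite_walk_targets x N) => y /gballE.
have [w xyw ->] := dist_walk x y => wr; exists w => //.
by rewrite -(ler_nat R) (le_trans (ltW wr)).
Qed.

Definition bseq x r : seq G := enum_fset (fset_set (gball mu x r)).

Lemma bseq_uniq x r : uniq (bseq x r). Proof. exact: fset_uniq. Qed.

Lemma mem_bseq x r y : (y \in bseq x r) = (dist x y < r).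
Proof.
rewrite in_fset_set; last exact: finite_gball.
by apply/idP/idP; rewrite inE gballE.
Qed.

Lemma volE x r : vol mu x r = \sum_(y <- bseq x r) mass mu y.
Proof. by rewrite /vol fsbig_finite//; exact: finite_gball. Qed.

Lemma vol_le x y r r' : (forall z, dist x z < r -> dist y z < r') -> vol mu x r <= vol mu y r'.
Proof.
move=> rr'; rewrite !volE; apply: ler_sum_uniq_sub; rewrite ?bseq_uniq//.
  by move=> z; rewrite !mem_bseq; exact: rr'.
by move=> z; exact: mass_ge0.
Qed.

Lemma vol_ge0 x r : 0 <= vol mu x r.
Proof. by rewrite volE sumr_ge0// => y _; exact: mass_ge0. Qed.

Lemma vol_ge_mass x r : 0 < r -> mass mu x <= vol mu x r.
Proof.
move=> r0; have -> : mass mu x = \sum_(y <- [:: x]) mass mu y by rewrite big_seq1.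
rewrite volE; apply: ler_sum_uniq_sub; rewrite ?bseq_uniq//; last by move=> y; exact: mass_ge0.
by move=> y; rewrite inE => /eqP ->; rewrite mem_bseq dist_refl.
Qed.


(** * Exponential weights at scale [sqrt s] *)

(* The weights are [exp (rate s * d (z, x))]: over [s] steps the walk moves by about
   [sqrt s], and the constant makes [P ^ s] bounded by [exp (1 / 8)] in the weighted norm. *)
Definition rate (s : nat) : R := eps / 6 / Num.sqrt s%:R.
Definition wgt (s : nat) (z x : G) : R := expR (rate s * dist z x).
Definition rho (s : nat) : R := expR (8 * s%:R)^-1.

Lemma rate_gt0 s : (0 < s)%N -> 0 < rate s.
Proof. by move=> s0; rewrite /rate !divr_gt0// sqrtr_gt0 ltr0n. Qed.

Lemma wgt_gt0 s z x : 0 < wgt s z x. Proof. exact: expR_gt0. Qed.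

Lemma wgt_ge0 s z x : 0 <= wgt s z x. Proof. exact: expR_ge0. Qed.

Lemma rate_ge0 s : 0 <= rate s.
Proof. by rewrite /rate !mulr_ge0 ?invr_ge0 ?sqrtr_ge0// ltW. Qed.

Lemma wgt_ge1 s z x : 1 <= wgt s z x.
Proof. by rewrite -expR0 ler_expR mulr_ge0 ?rate_ge0 ?dist_ge0. Qed.

Lemma sqrt_ge1 (s : nat) : (0 < s)%N -> 1 <= Num.sqrt s%:R :> R.
Proof. by move=> s0; rewrite -{1}[1]sqrtr1 ler_wsqrtr// ler1n. Qed.

Lemma rate_le s : (0 < s)%N -> forall x : G, rate s <= 1 / 6.
Proof.
move=> s0 x; rewrite /rate ler_pdivrMr ?(lt_le_trans _ (sqrt_ge1 s0))//.
have := sqrt_ge1 s0; have := eps_le1 x; lra.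
Qed.

(** The distances of neighbours to [z] differ by at most one, so their weights differ by a factor
    between [expR (- rate s)] and [expR (rate s)]; [rate s <= 1 / 6] puts both within [2 * rate s]
    of one. *)
Lemma wgt_adj s z x y : (0 < s)%N -> adj mu x y ->
  `|wgt s z y - wgt s z x| <= 2 * rate s * wgt s z x.
Proof.
move=> s0 xy; have a0 := rate_ge0 s; have a6 := rate_le s0 x; set a := rate s in a0 a6 *.
have yx : dist z y <= dist z x + 1.
  by apply: le_trans (dist_triangle z x y) _; rewrite lerD2l dist_adj.
have xy' : dist z x <= dist z y + 1.
  by apply: le_trans (dist_triangle z y x) _; rewrite lerD2l dist_adj// adj_sym.
have e1 : 1 - a <= expR (- a) by rewrite expR_ge1Dx.
have e2 : expR a <= 1 + 2 * a.
  have := expRxMexpNx_1 a; have := expR_gt0 a; set b := expR a; set c := expR (- a) in e1 *.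
  by move=> b0 bc; nra.
have up : wgt s z y <= expR a * wgt s z x.
  by rewrite /wgt -expRD ler_expR -/a; nra.
have lo : expR (- a) * wgt s z x <= wgt s z y.
  by rewrite /wgt -expRD ler_expR -/a; nra.
have := wgt_gt0 s z x; set u := wgt s z x in up lo *; set v := wgt s z y in up lo * => u0.
by rewrite ler_norml; apply/andP; split; nra.
Qed.

Lemma rho_gt0 s : 0 < rho s. Proof. exact: expR_gt0. Qed.

Lemma rho_ge1 s : 1 <= rho s. Proof. by rewrite -expR0 ler_expR invr_ge0 mulr_ge0. Qed.

Lemma rhoX s n : rho s ^+ n = expR (n%:R / (8 * s%:R)).
Proof. by rewrite -expRM_natl mulr_natl. Qed.

(** With [eta = 2 * rate s] the second order loss in [wle_markov] is [eps / (24 * s)]. As [eps <= 1]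
    this is at most [1 / (4 * s)], and [rho s ^+ 2] is at least [1 + 1 / (4 * s)]. *)
Lemma wle_markov_wgt s z f K : (0 < s)%N ->
  wle (mass mu) (wgt s z) f K -> wle (mass mu) (wgt s z) (markov_op mu f) (rho s * K).
Proof.
move=> s0; have a6 := rate_le s0 z.
apply: (@wle_markov _ _ _ (2 * rate s)).
- by move=> x; exact: wgt_ge0.
- by rewrite mulr_ge0 ?rate_ge0//=; lra.
- exact/ltW/rho_gt0.
- by move=> x y; exact: wgt_adj.
have s0' : 0 < s%:R :> R by rewrite ltr0n.
rewrite rhoX; apply: le_trans (expR_ge1Dx _); rewrite lerD2l.
rewrite /rate exprMn expr_div_n sqr_sqrtr ?ler0n//.
have -> : 3 / (8 * eps) * (2 ^+ 2 * ((eps / 6) ^+ 2 / s%:R)) = eps / (24 * s%:R).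
  by field; rewrite !gt_eqF.
have -> : 2 / (8 * s%:R) = 6 / (24 * s%:R) :> R by field; rewrite gt_eqF.
rewrite ler_pM2r ?invr_gt0 ?mulr_gt0//.
by have := eps_le1 z; lra.
Qed.

(** * Polynomials in the Markov operator: operator identities become polynomial identities *)

Definition pact (p : {poly R}) (f : G -> R) : G -> R :=
  \sum_(i < size p) p`_i *: iter i (markov_op mu) f.

Lemma pactE n (p : {poly R}) f : (size p <= n)%N ->
  pact p f = \sum_(i < n) p`_i *: iter i (markov_op mu) f.
Proof.
move=> pn; rewrite /pact (big_ord_widen n (fun i => p`_i *: iter i (markov_op mu) f))//.
rewrite big_mkcond; apply: eq_bigr => i _; case: ifPn => //; rewrite -leqNgt => ip.
by rewrite nth_default// scale0r.
Qed.

Lemma pactD p q f : pact (p + q) f = pact p f + pact q f.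
Proof.
pose n := maxn (size p) (size q).
rewrite (@pactE n p) ?leq_maxl// (@pactE n q) ?leq_maxr// (@pactE n) ?size_polyD//.
by rewrite -big_split; apply: eq_bigr => i _; rewrite coefD scalerDl.
Qed.

Lemma pactZ c p f : pact (c *: p) f = c *: pact p f.
Proof.
rewrite (@pactE (size p)) ?size_scale_leq// scaler_sumr.
by apply: eq_bigr => i _; rewrite coefZ scalerA.
Qed.

Lemma pactN p f : pact (- p) f = - pact p f.
Proof. by rewrite -scaleN1r pactZ scaleN1r. Qed.

Lemma pactB p q f : pact (p - q) f = pact p f - pact q f.
Proof. by rewrite pactD pactN. Qed.

Lemma pact0 f : pact 0 f = 0.
Proof. by rewrite /pact size_poly0 big_ord0. Qed.

Lemma pact_sum (I : Type) (r : seq I) (p : I -> {poly R}) f :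
  pact (\sum_(i <- r) p i) f = \sum_(i <- r) pact (p i) f.
Proof.
by elim: r => [|i r ih]; rewrite ?big_nil ?pact0// !big_cons pactD ih.
Qed.

Lemma pactC c f : pact c%:P f = c *: f.
Proof. by rewrite (@pactE 1) ?size_polyC_leq1// big_ord1 coefC. Qed.

Lemma pact1 f : pact 1 f = f.
Proof. by rewrite -polyC1 pactC scale1r. Qed.

Lemma markov_addf f g : markov_op mu (f + g) = markov_op mu f + markov_op mu g.
Proof. exact: markovD. Qed.

Lemma markov_scalef c f : markov_op mu (c *: f) = c *: markov_op mu f.
Proof. exact: markovZ. Qed.

Lemma markov_sumf (I : Type) (r : seq I) (f : I -> G -> R) :
  markov_op mu (\sum_(i <- r) f i) = \sum_(i <- r) markov_op mu (f i).
Proof.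
elim: r => [|i r ih]; last by rewrite !big_cons markov_addf ih.
by rewrite !big_nil; have := markov_scalef 0 0; rewrite !scale0r.
Qed.

Lemma pactMX p f : pact (p * 'X) f = markov_op mu (pact p f).
Proof.
rewrite (@pactE (size p).+1) ?(leq_trans (size_polyMleq _ _))//; last first.
  by rewrite size_polyX addn2.
rewrite big_ord_recl coefMX/= scale0r add0r markov_sumf; apply: eq_bigr => i _.
by rewrite coefMX/= markov_scalef.
Qed.

Lemma iter_markovD n f g :
  iter n (markov_op mu) (f + g) = iter n (markov_op mu) f + iter n (markov_op mu) g.
Proof. by elim: n => //= n ->; rewrite markov_addf. Qed.

Lemma iter_markovZ n c f : iter n (markov_op mu) (c *: f) = c *: iter n (markov_op mu) f.
Proof. by elim: n => //= n ->; rewrite markov_scalef. Qed.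

Lemma pactDf p f g : pact p (f + g) = pact p f + pact p g.
Proof. by rewrite /pact -big_split; apply: eq_bigr => i _; rewrite iter_markovD scalerDr. Qed.

Lemma pactZf p c f : pact p (c *: f) = c *: pact p f.
Proof.
rewrite /pact scaler_sumr; apply: eq_bigr => i _.
by rewrite iter_markovZ !scalerA mulrC.
Qed.

Lemma pactBf p f g : pact p (f - g) = pact p f - pact p g.
Proof. by rewrite -scaleN1r pactDf pactZf scaleN1r. Qed.

Lemma pactM p q f : pact (p * q) f = pact p (pact q f).
Proof.
elim/poly_ind: p => [|p c ih]; first by rewrite mul0r !pact0.
by rewrite mulrDl mulrAC !pactD !pactMX ih mul_polyC pactZ pactC.
Qed.

Lemma pactXn n f : pact 'X^n f = iter n (markov_op mu) f.
Proof. by elim: n => [|n ih]; rewrite ?expr0 ?pact1// exprSr pactMX ih. Qed.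

Lemma lap_pact f : lap mu f = pact (1 - 'X) f.
Proof. by rewrite pactB pact1 -['X]expr1 pactXn. Qed.

Lemma iter_lap_pact n f : iter n (lap mu) f = pact ((1 - 'X) ^+ n) f.
Proof.
elim: n => [|n ih]; first by rewrite expr0 pact1.
by rewrite iterS ih lap_pact -pactM -exprS.
Qed.

Lemma opBZ1_pact ss f : opBZ1 mu ss f = pact (\prod_(k <- ss) (1 - 'X^k)) f.
Proof.
elim: ss => [|k ss ih] /=; first by rewrite big_nil pact1.
by rewrite big_cons pactM -ih pactB pact1 pactXn.
Qed.

Lemma wle_iter s z f K n : (0 < s)%N -> wle (mass mu) (wgt s z) f K ->
  wle (mass mu) (wgt s z) (pact 'X^n f) (rho s ^+ n * K).
Proof.
move=> s0 fK; rewrite pactXn; elim: n => [|n ih]; first by rewrite mul1r.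
by rewrite exprS -mulrA; exact: wle_markov_wgt.
Qed.

(** The cofactor of [1 - 'X] in [1 - 'X^n]: what remains of [I - P ^ n] once the Laplacian has been
    taken out as a factor. *)
Definition psum (n : nat) : {poly R} := \sum_(i < n) 'X^i.

Lemma psumP n : (1 - 'X) * psum n = 1 - 'X^n.
Proof. by rewrite -[RHS]opprB subrX1 -mulNr opprB. Qed.

Lemma psumD a b : psum (a + b) = psum a + 'X^a * psum b.
Proof.
rewrite /psum big_split_ord mulr_sumr; congr (_ + _).
by apply: eq_bigr => i _ /=; rewrite exprD.
Qed.

Lemma psumM i s : psum (i * s) = \sum_(l < i) 'X^(l * s) * psum s.
Proof.
elim: i => [|i ih]; first by rewrite mul0n /psum !big_ord0.
by rewrite mulSn addnC psumD ih big_ord_recr.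
Qed.

Lemma wle_psum s z f K n : (0 < s)%N -> wle (mass mu) (wgt s z) f K ->
  wle (mass mu) (wgt s z) (pact (psum n) f) (n%:R * rho s ^+ n * K).
Proof.
move=> s0 fK; have K0 : 0 <= K by case: fK.
rewrite pact_sum fct_sumE.
have := @wle_sum _ _ _ mass_gt0 (wgt s z) _ (index_enum 'I_n) _ _ (wgt_ge0 s z)
  (fun i : 'I_n => wle_iter i s0 fK).
apply: wle_le; apply: (@le_trans _ _ (\sum_(i < n) rho s ^+ n * K)).
  apply: ler_sum => i _; apply: ler_wpM2r => //.
  by apply: ler_weXn2l; [exact: rho_ge1 | exact: ltnW].
by rewrite sumr_const card_ord -mulrA mulr_natl.
Qed.


(** * Square summability through finite sums *)

Lemma L2norm_le E f K : 0 <= K ->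
  (forall r : seq G, uniq r -> (forall x, x \in r -> E x) ->
    \sum_(x <- r) f x ^+ 2 * mass mu x <= K ^+ 2) ->
  (L2norm mu E f <= K%:E)%E.
Proof.
move=> K0 fK; rewrite /L2norm.
suff h : (\esum_(x in E) (`|f x| ^+ 2 * mass mu x)%:E <= (K ^+ 2)%:E)%E.
  apply: le_trans (gt0_ler_poweR _ _ _ h) _.
  - by [].
  - by rewrite in_itv/= leey esum_ge0// => x _; rewrite lee_fin mulr_ge0 ?mass_ge0 ?sqr_ge0.
  - by rewrite in_itv/= leey lee_fin sqr_ge0.
  by rewrite poweR_EFin powR12_sqrt ?sqr_ge0// sqrtr_sqr ger0_norm.
apply: ge_ereal_sup => _ [A [finA AE] <-].
rewrite fsbig_finite//= sumEFin lee_fin.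
under eq_bigr do rewrite real_normK ?num_real//.
apply: fK => [|x]; first exact: fset_uniq.
by rewrite in_fset_set// inE => /AE.
Qed.

Lemma L2_wle f : L2 mu f <-> exists K, wle (mass mu) (fun=> 1) f K.
Proof.
split=> [|[K [K0 fK]]].
  rewrite /L2/= /L2norm; set S := (\esum_(x in _) _)%E => fS.
  have S0 : (0 <= S)%E.
    by apply: esum_ge0 => x _; rewrite lee_fin mulr_ge0 ?mass_ge0 ?sqr_ge0.
  have Sfin : S \is a fin_num.
    by rewrite ge0_fin_numE//; apply: lty_poweRy fS; rewrite invr_eq0.
  exists (Num.sqrt (fine S)); split; first exact: sqrtr_ge0.
  move=> E uE; rewrite sqr_sqrtr ?fine_ge0// -lee_fin fineK//.
  apply: ereal_sup_ubound; exists [set` E]; first by split.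
  rewrite -fsbig_seq// sumEFin; congr (_%:E); apply: eq_bigr => x _.
  by rewrite real_normK ?num_real// mul1r.
apply: le_lt_trans (ltry K); apply: L2norm_le => // r ur _.
by apply: le_trans (fK r ur); apply: ler_sum => x _; rewrite mul1r.
Qed.


(** * The resolvent as a geometric average of powers *)

Definition theta (s : nat) : R := s%:R / s.+1%:R.

(** From [I + s Delta = (1 + s) (I - theta P)] the resolvent is the Neumann series with these
    coefficients. *)
Definition geo (s n : nat) : R := theta s ^+ n / s.+1%:R.

Lemma theta_ge0 s : 0 <= theta s. Proof. by rewrite divr_ge0. Qed.

Lemma theta_lt1 s : theta s < 1. Proof. by rewrite ltr_pdivrMr ?mul1r ?ltr_nat. Qed.

Lemma geo_ge0 s n : 0 <= geo s n. Proof. by rewrite divr_ge0 ?exprn_ge0 ?theta_ge0. Qed.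

(** [theta s = 1 - 1 / (s + 1)] is at most [1 - 1 / (2 * s)], hence at most [expR (- 1 / (2 * s))],
    the inverse of [rho s ^+ 4]. Growth like [rho s ^+ n] is thus absorbed with room to spare. *)
Lemma theta_rho s : (0 < s)%N -> theta s * rho s ^+ 4 <= 1.
Proof.
move=> s0; have s1 : 1 <= s%:R :> R by rewrite ler1n.
rewrite rhoX; set x := 4%:R / _; rewrite -[leRHS](expRxMexpNx_1 x) mulrC ler_pM2l ?expR_gt0//.
apply: le_trans (expR_ge1Dx _); rewrite /theta -natr1 ler_pdivrMr; last by lra.
have -> : x = s%:R^-1 / 2 by rewrite /x; field; rewrite gt_eqF//; lra.
have is1 : s%:R^-1 * s%:R = 1 :> R by rewrite mulVf// gt_eqF//; lra.
have : s%:R^-1 <= 1 :> R by rewrite invf_le1; lra.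
by set i := s%:R^-1 in is1 *; nra.
Qed.

(* Bounds, uniformly in [s], the number of admissible factors [1 - 'X^k] that are
   spent on [1 - 'X^n] in [psum_shift], averaged over the geometric law [geo s]. *)
Lemma sum_geo_le s N : (0 < s)%N ->
  \sum_(n < N) geo s n * (rho s ^+ n * (n%:R / s%:R + 2)) <= 32.
Proof.
(* One more power [rho s ^+ n] dominates [n / s + 2] up to the factor 8, whence the ratio [y]. The
   two other powers of [rho s] in [theta_rho] make [1 - y] at least [1 / (4 * s + 1)], and
   [8 * (4 * s + 1) / (s + 1) <= 32]. *)
move=> s0; have s1 : 1 <= s%:R :> R by rewrite ler1n.
pose y := theta s * rho s ^+ 2.
have y0 : 0 <= y by rewrite mulr_ge0 ?theta_ge0// exprn_ge0// ltW// rho_gt0.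
have y1 : y * (4 * s%:R + 1) <= 4 * s%:R.
  have r2 : 1 + 1 / (4 * s%:R) <= rho s ^+ 2.
    rewrite rhoX; apply: le_trans (expR_ge1Dx _).
    by rewrite lerD2l le_eqVlt; apply/predU1P; left; field; rewrite gt_eqF//; lra.
  have := theta_rho s0; rewrite -[4%N]/(2 * 2)%N exprM (expr2 (_ ^+ 2)) mulrA -/y => yr.
  have : y * (1 + 1 / (4 * s%:R)) <= 1 by apply: le_trans yr; rewrite ler_wpM2l.
  rewrite -(ler_pM2r (_ : 0 < 4 * s%:R)) ?mul1r; last by lra.
  by congr (_ <= _); field; rewrite gt_eqF//; lra.
apply: (@le_trans _ _ (\sum_(n < N) 8 / s.+1%:R * y ^+ n)).
  apply: ler_sum => n _; rewrite /geo /y (exprMn n (theta s)) -exprM mulnC exprM expr2.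
  have e1 : 1 + n%:R / (8 * s%:R) <= rho s ^+ n by rewrite rhoX expR_ge1Dx.
  have e8 : n%:R / (8 * s%:R) = (n%:R / s%:R) / 8 :> R by field; rewrite gt_eqF//; lra.
  rewrite e8 in e1.
  have e2 : n%:R / s%:R + 2 <= 8 * rho s ^+ n by lra.
  have T0 : 0 <= theta s ^+ n * rho s ^+ n / s.+1%:R.
    by rewrite divr_ge0// mulr_ge0// exprn_ge0 ?theta_ge0// ltW// rho_gt0.
  by have := ler_wpM2l T0 e2; congr (_ <= _); ring.
rewrite -mulr_sumr.
have S0 : 0 <= \sum_(n < N) y ^+ n by apply: sumr_ge0 => n _; rewrite exprn_ge0.
have : \sum_(n < N) y ^+ n * (1 - y) <= 1.
  by rewrite -mulr_suml mulrC -opprB mulNr -subrX1 opprB gerBl exprn_ge0.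
rewrite -mulr_suml; set S := \sum_(n < N) _ => Sy.
have S4 : S <= 4 * s%:R + 1.
  have h : S * (1 - y) * (4 * s%:R + 1) <= 4 * s%:R + 1.
    by rewrite -[leRHS]mul1r ler_wpM2r//; lra.
  by apply: le_trans h; rewrite -mulrA ler_peMr//; lra.
rewrite -natr1 mulrAC ler_pdivrMr; last by lra.
by lra.
Qed.


Lemma geoE s n : geo s n = theta s ^+ n - theta s ^+ n.+1.
Proof.
by rewrite /geo exprSr /theta -!natr1; field; rewrite natr1 pnatr_eq0.
Qed.

Lemma theta_s s : theta s * (1 + s%:R) = s%:R.
Proof. by rewrite /theta addrC natr1 mulfVK ?pnatr_eq0. Qed.

Definition pres (s : nat) : {poly R} := 1 + s%:R *: (1 - 'X).

Lemma pres_pact s g : pact (pres s) g = g + s%:R *: lap mu g.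
Proof. by rewrite pactD pact1 pactZ lap_pact. Qed.

Definition pgeo (s N : nat) : {poly R} := \sum_(n < N) geo s n *: 'X^n.

(** Telescoping, because [theta s * (1 + s) = s]: partial Neumann sums invert [I + s Delta] up to a
    single remainder term. *)
Lemma pres_pgeo s N : pres s * pgeo s N = 1 - theta s ^+ N *: 'X^N.
Proof.
elim: N => [|N ih]; first by rewrite /pgeo big_ord0 mulr0 !expr0 scale1r subrr.
rewrite /pgeo big_ord_recr/= mulrDr ih geoE /pres !exprSr -!mul_polyC.
have := congr1 polyC (theta_s s); rewrite (polyCM (theta s)) polyCD polyC1 => ts.
rewrite polyCB !(polyCM (theta s ^+ N), polyCM (theta s ^+ N * theta s)).
set t := (theta s)%:P in ts *; set c := (theta s ^+ N)%:P.
set u := (s%:R)%:P in ts *; set x := 'X; set y := 'X^N.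
apply/eqP; rewrite -subr_eq0; apply/eqP.
transitivity (c * y * (u - t * (1 + u)) * (1 - x)); first by ring.
by rewrite ts subrr mulr0 mul0r.
Qed.

(* Abel summation of [s R = \sum_n geo s n *: psum n], with its remainder. *)
Lemma psum_geo s N :
  s%:R%:P = (\sum_(n < N) geo s n *: psum n + theta s ^+ N *: psum N) * pres s
    + (theta s ^+ N * s%:R) *: 'X^N.
Proof.
elim: N => [|N ih].
  by rewrite big_ord0 /psum big_ord0 scaler0 addr0 mul0r add0r expr0 mul1r expr0 alg_polyC.
have pS : psum N.+1 = psum N + 'X^N by rewrite /psum big_ord_recr.
rewrite {1}ih big_ord_recr/= pS /pres.
rewrite geoE !exprSr -!mul_polyC.
have := congr1 polyC (theta_s s); rewrite (polyCM (theta s)) polyCD polyC1 => ts.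
rewrite polyCB !(polyCM (theta s ^+ N), polyCM (theta s ^+ N * theta s)).
set t := (theta s)%:P in ts *; set c := (theta s ^+ N)%:P.
set u := (s%:R)%:P in ts *; set x := 'X; set y := 'X^N; set S := \sum_(n < N) _.
apply/eqP; rewrite -subr_eq0; apply/eqP.
transitivity (c * y * (u - t * (1 + u))); first by ring.
by rewrite ts subrr mulr0.
Qed.

Lemma pact_cvg p (f : nat -> G -> R) g :
  (forall x, f n x @[n --> \oo] --> g x) ->
  forall x, pact p (f n) x @[n --> \oo] --> pact p g x.
Proof.
move=> fg x; elim/poly_ind: p x => [|p c ih] x.
  by rewrite pact0; under eq_fun do rewrite pact0; exact: cvg_cst.
rewrite pactD pactMX pactC; under eq_fun do rewrite pactD pactMX pactC.
by apply: cvgD; [exact: markov_cvg | apply: cvgMl_tmp; exact: fg].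
Qed.

Lemma cvg_theta s (c : R) : c * theta s ^+ n @[n --> \oo] --> 0.
Proof.
rewrite -[X in _ --> X](mulr0 c); apply: cvgMl_tmp; apply: cvg_expr.
by rewrite ger0_norm ?theta_ge0 ?theta_lt1.
Qed.

(** The partial Neumann sums are bounded by [32 * K] in the weighted norm and converge absolutely at
    each point. The limit keeps the bound, and the equation passes to the limit since a polynomial
    in [P] reads finitely many values. *)
Lemma resolvent_ex s z f K : (0 < s)%N -> wle (mass mu) (wgt s z) f K ->
  exists2 g, wle (mass mu) (wgt s z) g (32 * K) & pact (pres s) g = f.
Proof.
move=> s0 fK; have K0 : 0 <= K by case: fK.
have pgE N x : pact (pgeo s N) f x = \sum_(n < N) geo s n * pact 'X^n f x.
  by rewrite pact_sum fct_sumE; apply: eq_bigr => n _; rewrite pactZ.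
have s32 N : \sum_(n < N) geo s n * rho s ^+ n <= 32.
  apply: le_trans (sum_geo_le N s0); apply: ler_sum => n _.
  rewrite ler_wpM2l ?geo_ge0// ler_peMr ?exprn_ge0// ?ltW ?rho_gt0//.
  have : 0 <= n%:R / s%:R :> R by rewrite divr_ge0.
  by lra.
have wN N : wle (mass mu) (wgt s z) (pact (pgeo s N) f) (32 * K).
  rewrite (funext (pgE N)).
  have := @wle_sum _ _ _ mass_gt0 (wgt s z) _ (index_enum 'I_N) _ _ (wgt_ge0 s z)
    (fun n : 'I_N => wleZ (geo s n) (wle_iter n s0 fK)).
  apply: wle_le; apply: le_trans (ler_wpM2r K0 (s32 N)).
  rewrite mulr_suml ler_sum// => n _.
  by rewrite (ger0_norm (geo_ge0 _ _)) mulrA.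
pose g x := limn (fun N => pact (pgeo s N) f x).
have pgS x : (fun N => pact (pgeo s N) f x) = series (fun n => geo s n * pact 'X^n f x).
  by apply/funext => N; rewrite pgE seriesEord.
have pg x : pact (pgeo s N) f x @[N --> \oo] --> g x.
  rewrite /g pgS; apply: normed_cvg; apply: nondecreasing_is_cvgn.
    by apply: nondecreasing_series => n _ _; rewrite normr_ge0.
  set c := K / Num.sqrt (wgt s z x * mass mu x).
  have c0 : 0 <= c by rewrite divr_ge0 ?sqrtr_ge0.
  exists (32 * c) => _ [N _ <-] /=; rewrite seriesEord.
  apply: le_trans (ler_wpM2r c0 (s32 N)); rewrite mulr_suml ler_sum// => n _.
  rewrite normrM (ger0_norm (geo_ge0 _ _)) -[leRHS]mulrA ler_wpM2l ?geo_ge0//.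
  by rewrite mulrA; apply: (wle_pointwise mass_gt0 (wgt_gt0 s z x)); exact: wle_iter.
exists g; first exact: wle_cvg wN pg.
apply/funext => x; have px := @pact_cvg (pres s) _ _ pg x.
have eqf : (fun N => pact (pres s) (pact (pgeo s N) f) x) =
    (fun N => f x - theta s ^+ N * pact 'X^N f x).
  by apply/funext => N; rewrite -pactM pres_pgeo pactB pact1 pactZ.
rewrite eqf in px.
suff : f x - theta s ^+ N * pact 'X^N f x @[N --> \oo] --> f x by apply: cvg_unique px.
rewrite -[X in _ --> X]subr0; apply: cvgB; first exact: cvg_cst.
(* The terms of a convergent series tend to zero, and up to the factor [s.+1] they are the
   remainders [theta s ^+ N * pact 'X^N f x]. *)
have : cvgn (series (fun n => geo s n * pact 'X^n f x)).
  by rewrite -pgS; apply/cvg_ex; exists (g x).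
move/cvg_series_cvg_0 => /(cvgMl_tmp (a := s.+1%:R)).
rewrite mulr0; under eq_fun do rewrite /geo mulrA mulrCA mulfV ?pnatr_eq0// mulr1.
by [].
Qed.


Definition wL2 s z (f : G -> R) := exists K, wle (mass mu) (wgt s z) f K.

Lemma wL2_L2 s z f : wL2 s z f -> L2 mu f.
Proof.
move=> [K fK]; apply/L2_wle; exists K; apply: wle_weight fK; first exact: mass_gt0.
by move=> x; exact: wgt_ge1.
Qed.

Lemma wL2D s z f g : wL2 s z f -> wL2 s z g -> wL2 s z (f + g).
Proof.
by move=> [K fK] [L gL]; exists (K + L); apply: wleD => //; [exact: mass_gt0|exact: wgt_ge0].
Qed.

Lemma wL2Z s z c f : wL2 s z f -> wL2 s z (c *: f).
Proof. by move=> [K fK]; exists (`|c| * K); exact: wleZ. Qed.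

Lemma wL2_pact s z p f : (0 < s)%N -> wL2 s z f -> wL2 s z (pact p f).
Proof.
move=> s0; elim/poly_ind: p f => [|p c ih] f fw.
  by rewrite pact0; exists 0; exact: wle0.
rewrite pactD pactMX pactC; apply: wL2D; last exact: wL2Z.
by have [K fK] := ih f fw; exists (rho s * K); exact: wle_markov_wgt.
Qed.

Lemma wL2_supp s z f : finitely_supported f -> wL2 s z f.
Proof.
move=> ff; eexists; apply: (@wle_supp _ _ _ mass_gt0 _ _ (fset_set [set x | f x != 0])).
- exact: wgt_ge0.
- exact: fset_uniq.
- by move=> x fx; rewrite in_fset_set// inE.
Qed.

(** A solution satisfies [h = theta s *: markov_op mu h]; as [P] contracts [L^2] and [theta s < 1],
    iterating forces [h = 0]. *)
Lemma pres_eq0 s h : L2 mu h -> pact (pres s) h = 0 -> h = 0.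
Proof.
move=> /L2_wle[K hK] h0; have hP : h = theta s *: markov_op mu h.
  have : pact (pres s) h = (1 + s%:R) *: h - s%:R *: markov_op mu h.
    rewrite pres_pact lap_pact pactB pact1 -['X]expr1 pactXn scalerBr scalerDl scale1r.
    by rewrite addrA.
  rewrite h0 => /esym/eqP; rewrite subr_eq0 => /eqP hs.
  have s1 : 1 + s%:R != 0 :> R by rewrite addrC natr1 pnatr_eq0.
  by rewrite -[h in LHS](scalerK s1) hs scalerA /theta -natr1 [in RHS]addrC mulrC.
have hn n : wle (mass mu) (fun=> 1) h (theta s ^+ n * K).
  elim: n => [|n ih]; first by rewrite mul1r.
  rewrite hP exprS -mulrA -[X in X * _](ger0_norm (theta_ge0 s)); apply: wleZ.
  exact: wle_markov_contract.
apply/funext => x; apply/eqP; rewrite -normr_le0.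
pose c := Num.sqrt (1 * mass mu x); have c0 : 0 < c by rewrite sqrtr_gt0 mul1r mass_gt0.
have := @cvg_theta s (K / c) => lim; rewrite -(cvg_lim _ lim)//.
apply: limr_ge; first by apply/cvg_ex; exists 0.
near=> n; rewrite mulrAC (mulrC K).
exact: (wle_pointwise mass_gt0 (w := fun=> 1) ltr01 (hn n)).
Unshelve. all: by end_near. Qed.

Lemma resolvent_eq s f g : L2 mu g -> pact (pres s) g = f -> resolvent mu s f = g.
Proof.
move=> gL gf; apply: xget_unique.
  by split=> //; rewrite -gf pres_pact.
move=> h [hL hf]; apply/eqP; rewrite -subr_eq0; apply/eqP; apply: (@pres_eq0 s).
  move/L2_wle: hL => [K hK]; move/L2_wle: gL => [L gL].
  apply/L2_wle; exists (K + `|-1| * L); rewrite -scaleN1r.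
  by apply: wleD => //; [exact: mass_gt0 | exact: wleZ].
by rewrite pactBf gf pres_pact -hf subrr.
Qed.

Lemma resolvent_wle s z f K : (0 < s)%N -> wle (mass mu) (wgt s z) f K ->
  wle (mass mu) (wgt s z) (resolvent mu s f) (32 * K).
Proof.
move=> s0 fK; have [g gK gf] := resolvent_ex s0 fK.
by rewrite (resolvent_eq _ gf)//; apply: wL2_L2; exists (32 * K); exact: gK.
Qed.

Lemma wL2_resolvent s z f : (0 < s)%N -> wL2 s z f -> wL2 s z (resolvent mu s f).
Proof. by move=> s0 [K fK]; exists (32 * K); exact: resolvent_wle. Qed.

Lemma resolventK s z f : (0 < s)%N -> wL2 s z f -> pact (pres s) (resolvent mu s f) = f.
Proof.
move=> s0 [K fK]; have [g gK gf] := resolvent_ex s0 fK.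
by rewrite (resolvent_eq _ gf)//; apply: wL2_L2; exists (32 * K); exact: gK.
Qed.

Lemma resolvent_pact s z p f : (0 < s)%N -> wL2 s z f ->
  resolvent mu s (pact p f) = pact p (resolvent mu s f).
Proof.
move=> s0 fw; apply: resolvent_eq.
  by apply: (@wL2_L2 s z); apply: wL2_pact => //; exact: wL2_resolvent.
by rewrite -pactM mulrC pactM (@resolventK s z).
Qed.

Lemma resolventD s z c f g : (0 < s)%N -> wL2 s z f -> wL2 s z g ->
  resolvent mu s (c *: f + g) = c *: resolvent mu s f + resolvent mu s g.
Proof.
move=> s0 fw gw; apply: resolvent_eq.
  by apply: (@wL2_L2 s z); apply: wL2D; [apply: wL2Z|]; exact: wL2_resolvent.
by rewrite pactDf pactZf !(@resolventK s z).
Qed.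

Lemma wL2_iter s z n f : (0 < s)%N -> wL2 s z f ->
  wL2 s z (iter n (fun g => s%:R *: resolvent mu s g) f).
Proof. by move=> s0 fw; elim: n => //= n ih; apply: wL2Z; exact: wL2_resolvent. Qed.

Lemma iter_resolventD s z n c f g : (0 < s)%N -> wL2 s z f -> wL2 s z g ->
  iter n (fun h => s%:R *: resolvent mu s h) (c *: f + g) =
  c *: iter n (fun h => s%:R *: resolvent mu s h) f + iter n (fun h => s%:R *: resolvent mu s h) g.
Proof.
move=> s0 fw gw; elim: n => //= n ->; rewrite (@resolventD s z)//; try exact: wL2_iter.
by rewrite scalerDr !scalerA mulrC.
Qed.

(** [I - R = s Delta R] and [R] commutes with polynomials in [P], so the operator is
    [Delta^M (s R)^M]. This exhibits a potential in the sense of [M0]. *)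
Lemma opBZ2_potential s z M f : (0 < s)%N -> wL2 s z f ->
  opBZ2 mu M s f = pact ((1 - 'X) ^+ M) (iter M (fun g => s%:R *: resolvent mu s g) f).
Proof.
move=> s0 fw; rewrite /opBZ2; elim: M => [|M ih]; first by rewrite expr0 pact1.
rewrite !iterS ih; set u := iter M _ f; have uw : wL2 s z u by exact: wL2_iter.
rewrite [LHS](_ : _ = pact ((1 - 'X) ^+ M) u - resolvent mu s (pact ((1 - 'X) ^+ M) u))//.
rewrite (@resolvent_pact s z)// -pactBf exprSr pactM; congr pact.
rewrite -{1}(@resolventK s z u)// pres_pact addrAC subrr add0r.
by rewrite lap_pact pactZf.
Qed.

(** * Factorisation of [I - P ^ k] through [I - R] *)

Definition Tpol (s k : nat) : {poly R} := 1 - 'X^k + s%:R^-1 *: psum k.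

Lemma pres_psum s k : (0 < s)%N -> pres s * (s%:R^-1 *: psum k) = Tpol s k.
Proof.
move=> s0; rewrite /pres mulrDl mul1r /Tpol addrC; congr (_ + _).
by rewrite -scalerAl -scalerAr scalerA psumP mulfV ?scale1r// pnatr_eq0 -lt0n.
Qed.

(** By [pres_psum], [R T_k = s^-1 psum k], so that [T_k - R T_k = I - P ^ k]; the factors commute
    and are peeled off one at a time. *)
Lemma opBZ2_Tpol s z (ks : seq nat) f : (0 < s)%N -> wL2 s z f ->
  opBZ2 mu (size ks) s (pact (\prod_(k <- ks) Tpol s k) f) = opBZ1 mu ks f.
Proof.
move=> s0; rewrite opBZ1_pact.
elim: ks f => [|k ks ih] f fw; first by rewrite !big_nil.
rewrite /opBZ2 [size _]/= iterSr !big_cons; set Q := \prod_(j <- ks) Tpol s j in ih *.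
rewrite [X in iter _ _ X](_ : _ = pact Q (pact (1 - 'X^k) f)).
  by rewrite mulrC pactM; apply: ih; exact: wL2_pact.
have -> : resolvent mu s (pact (Tpol s k * Q) f) = pact (s%:R^-1 *: psum k * Q) f.
  apply: resolvent_eq; first by apply: (@wL2_L2 s z); exact: wL2_pact.
  by rewrite -pactM mulrA pres_psum.
rewrite -[LHS]/(pact (Tpol s k * Q) f - pact (s%:R^-1 *: psum k * Q) f).
by rewrite -pactB -mulrBl /Tpol addrK mulrC pactM.
Qed.

Lemma rho_2s s : (0 < s)%N -> rho s ^+ (2 * s) <= 2.
Proof.
move=> s0; rewrite rhoX; have -> : (2 * s)%:R / (8 * s%:R) = 4^-1 :> R.
  by rewrite natrM; field; rewrite pnatr_eq0 -lt0n.
have := expRxMexpNx_1 (4^-1 : R); have := expR_ge1Dx (- 4^-1 : R).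
by have := expR_gt0 (4^-1 : R); set a := expR _; set b := expR _ => a0 b0 ab; nra.
Qed.

(** For [k <= 2 s] the growth [rho s ^+ k] is at most 2, so the three terms of [Tpol] contribute 1,
    2 and [(k / s) * 2 <= 4]. *)
Lemma wle_Tpol s z k f K : (0 < s)%N -> (k <= 2 * s)%N -> wle (mass mu) (wgt s z) f K ->
  wle (mass mu) (wgt s z) (pact (Tpol s k) f) (7 * K).
Proof.
move=> s0 ks fK; have K0 : 0 <= K by case: fK.
have s00 : 0 < s%:R :> R by rewrite ltr0n.
have rk : rho s ^+ k <= 2.
  by apply: le_trans (rho_2s s0); apply: ler_weXn2l => //; exact: rho_ge1.
have rk0 : 0 <= rho s ^+ k by rewrite exprn_ge0// ltW// rho_gt0.
rewrite /Tpol pactD pactB pact1 pactZ -scaleN1r.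
have w0 := wgt_ge0 s z; have w1 := wleZ (-1) (wle_iter k s0 fK).
have w2 := wleZ s%:R^-1 (wle_psum k s0 fK).
apply: wle_le (wleD mass_gt0 w0 (wleD mass_gt0 w0 fK w1) w2).
rewrite normrN normr1 mul1r ger0_norm ?invr_ge0// -!mulrA mulrA.
have k2 : s%:R^-1 * k%:R <= 2 :> R.
  by rewrite mulrC ler_pdivrMr// -natrM ler_nat.
have k0 : 0 <= s%:R^-1 * k%:R :> R by rewrite mulr_ge0// invr_ge0.
have h1 : rho s ^+ k * K <= 2 * K by rewrite ler_wpM2r.
have h2 : s%:R^-1 * k%:R * (rho s ^+ k * K) <= 2 * (2 * K).
  by apply: ler_pM => //; rewrite mulr_ge0.
by lra.
Qed.

Lemma wle_prod_Tpol s z (ks : seq nat) f K : (0 < s)%N ->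
  all (fun k => k <= 2 * s)%N ks -> wle (mass mu) (wgt s z) f K ->
  wle (mass mu) (wgt s z) (pact (\prod_(k <- ks) Tpol s k) f) (7 ^+ size ks * K).
Proof.
move=> s0; elim: ks => [|k ks ih] /=; first by rewrite big_nil pact1 mul1r.
move=> /andP[ks2 kss] fK; rewrite big_cons pactM exprS -mulrA.
by apply: wle_Tpol => //; exact: ih.
Qed.


(** * Functionals evaluated on powers of the resolvent *)

Lemma theta_rho2_lt1 s : (0 < s)%N -> theta s * rho s ^+ 2 < 1.
Proof.
move=> s0; have r1 : 1 < rho s ^+ 2.
  by rewrite rhoX pexpR_gt1// divr_gt0// mulr_gt0// ltr0n.
have := theta_rho s0; rewrite -[4%N]/(2 * 2)%N exprM (expr2 (_ ^+ 2)) mulrA.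
have y0 : 0 <= theta s * rho s ^+ 2 by rewrite mulr_ge0 ?theta_ge0// ltW// (lt_trans ltr01).
set y := theta s * _ in y0 *; set r := rho s ^+ 2 in r1 * => yr; nra.
Qed.

Lemma ler_geometric_limit (a b c y : R) : 0 <= y < 1 ->
  (forall N : nat, a <= b + c * y ^+ N) -> a <= b.
Proof.
move=> /andP[y0 y1] aN.
have lim : b + c * y ^+ N @[N --> \oo] --> b.
  rewrite -[X in _ --> X]addr0; apply: cvgD; first exact: cvg_cst.
  by rewrite -[X in _ --> X](mulr0 c); apply: cvgMl_tmp; apply: cvg_expr; rewrite ger0_norm.
rewrite -(cvg_lim _ lim)//; apply: limr_ge; first by apply/cvg_ex; exists b.
by near=> N; exact: aN.
Unshelve. all: by end_near. Qed.

Lemma psum_shift s i j :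
  psum (i * s + j) = \sum_(l < i) 'X^(l * s) * psum s
    + ('X^(i * s) * psum (s + j) - 'X^(i * s + j) * psum s).
Proof. by rewrite psumD psumM addnC psumD exprD; ring. Qed.

Lemma iter_resolvent_pact s z n p f : (0 < s)%N -> wL2 s z f ->
  iter n (fun g => s%:R *: resolvent mu s g) (pact p f) =
  pact p (iter n (fun g => s%:R *: resolvent mu s g) f).
Proof.
move=> s0 fw; elim: n => //= n ->.
by rewrite (@resolvent_pact s z)// ?pactZf//; exact: wL2_iter.
Qed.

(* [s R = \sum_n geo s n *: psum n], and [psum_shift] writes every [psum n] with
   [psum k] for [s <= k <= 2 s] only: an index [j < s] is reached from [s + j]. *)
Lemma functional_resolvent_le s z (phi : G -> R) (M : nat) (L : (G -> R) -> R) (K0 : R) :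
  (0 < s)%N -> wL2 s z phi -> 0 <= K0 ->
  (forall c f g, wL2 s z f -> wL2 s z g -> L (c *: f + g) = c * L f + L g) ->
  (exists C, forall f K, wle (mass mu) (wgt s z) f K -> `|L f| <= C * K) ->
  (forall (ks : seq nat) e, size ks = M -> all (fun k => s <= k <= 2 * s)%N ks ->
    `|L (pact (\prod_(k <- ks) psum k * 'X^e) phi)| <= K0 * rho s ^+ e) ->
  forall e, `|L (iter M (fun g => s%:R *: resolvent mu s g) (pact 'X^e phi))| <=
    K0 * 32 ^+ M * rho s ^+ e.
Proof.
move=> s0 phiw K00; have r0 n : 0 <= rho s ^+ n by rewrite exprn_ge0// ltW// rho_gt0.
elim: M L => [|M ih] L linL contL hL e.
  by have := hL [::] e erefl isT; rewrite big_nil mul1r expr0 mulr1.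
have s00 : 0 < s%:R :> R by rewrite ltr0n.
pose u e := iter M (fun g => s%:R *: resolvent mu s g) (pact 'X^e phi).
have uw e' : wL2 s z (u e') by apply: wL2_iter => //; exact: wL2_pact.
have Xu j e' : pact 'X^j (u e') = u (j + e')%N.
  by rewrite /u -(@iter_resolvent_pact s z)//; [rewrite -pactM -exprD | exact: wL2_pact].
have L0 : L 0 = 0.
  have w0 : wL2 s z 0 by exists 0; exact: wle0.
  by have := linL 1 _ _ w0 w0; rewrite scale1r addr0 mul1r; lra.
have LD f g : wL2 s z f -> wL2 s z g -> L (f + g) = L f + L g.
  by move=> fw gw; have := linL 1 _ _ fw gw; rewrite scale1r mul1r.
have LZ c f : wL2 s z f -> L (c *: f) = c * L f.
  move=> fw; have w0 : wL2 s z 0 by exists 0; exact: wle0.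
  by have := linL c _ _ fw w0; rewrite L0 !addr0.
have Lsum (n : nat) (f : nat -> G -> R) : (forall i, wL2 s z (f i)) ->
    L (\sum_(i < n) f i) = \sum_(i < n) L (f i).
  move=> fw; elim: n => [|n ihn]; first by rewrite !big_ord0.
  rewrite !big_ord_recr LD ?ihn//.
  elim: n {ihn} => [|n ihn]; first by rewrite big_ord0; exists 0; exact: wle0.
  by rewrite big_ord_recr; apply: wL2D.
have [C LC] := contL.
have C0 f K : wle (mass mu) (wgt s z) f K -> `|L f| <= `|C| * K.
  move=> fK; apply: le_trans (LC _ _ fK) _; rewrite ler_wpM2r ?ler_norm//.
  by case: fK.
pose A := K0 * 32 ^+ M; have A0 : 0 <= A by rewrite mulr_ge0// exprn_ge0.
(* The induction hypothesis, used for [L] composed with [psum k], handles the [M] resolvents in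
   [u e']. *)
have Lk k e' : (s <= k <= 2 * s)%N -> `|L (pact (psum k) (u e'))| <= A * rho s ^+ e'.
  move=> sk; apply: (ih (fun f => L (pact (psum k) f))).
  - move=> c f g fw gw; rewrite pactDf pactZf linL//; exact: wL2_pact.
  - exists (`|C| * (k%:R * rho s ^+ k)) => f K fK; rewrite -mulrA; apply: C0.
    exact: wle_psum.
  - move=> ks e'' ksM ksk; have := hL (k :: ks) e''; rewrite big_cons /= ksM sk ksk.
    by rewrite -mulrA pactM; apply.
(* With [i = n %/ s], [psum_shift] produces [i] terms with [psum s] and two more, all of admissible
   index; hence the count [n / s + 2]. *)
have Ln n e' : `|L (pact (psum n) (u e'))| <= (rho s ^+ n * (n%:R / s%:R + 2)) * (A * rho s ^+ e').
  rewrite {1}(divn_eq n s) psum_shift; set i := (n %/ s)%N; set j := (n %% s)%N.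
  have jn : (i * s + j)%N = n by rewrite -divn_eq.
  have js : (j < s)%N by rewrite ltn_mod.
  rewrite pactD pactB pact_sum; under eq_bigr do rewrite mulrC pactM Xu.
  rewrite !(mulrC 'X^_) !pactM !Xu.
  have pw k e'' : wL2 s z (pact (psum k) (u e'')) by exact: wL2_pact.
  rewrite [X in L (_ + X)](_ : _ = -1 *: pact (psum s) (u (i * s + j + e')%N)
    + pact (psum (s + j)) (u (i * s + e')%N)); last by rewrite scaleN1r addrC.
  have sumw : wL2 s z (\sum_(l < i) pact (psum s) (u (l * s + e')%N)).
    elim: (i) => [|i' ihi]; first by rewrite big_ord0; exists 0; exact: wle0.
    by rewrite big_ord_recr; apply: wL2D.
  rewrite LD//; last by apply: wL2D => //; exact: wL2Z.
  rewrite linL// (Lsum i (fun l => pact (psum s) (u (l * s + e')%N)))//.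
  have rr e'' : (e'' <= n)%N -> A * rho s ^+ (e'' + e') <= rho s ^+ n * (A * rho s ^+ e').
    move=> en; rewrite exprD mulrCA; apply: ler_wpM2r; first by rewrite mulr_ge0.
    by apply: ler_weXn2l => //; exact: rho_ge1.
  set T := rho s ^+ n * (A * rho s ^+ e').
  have T0 : 0 <= T by rewrite /T !mulr_ge0.
  have in_s : i%:R <= n%:R / s%:R :> R by rewrite ler_pdivlMr// -natrM ler_nat leq_divM.
  have h1 : `|\sum_(l < i) L (pact (psum s) (u (l * s + e')%N))| <= i%:R * T.
    apply: le_trans (ler_norm_sum _ _ _) _; rewrite -[i in leRHS]card_ord mulr_natl -sumr_const.
    apply: ler_sum => l _; apply: le_trans (Lk _ _ _) (rr _ _); first lia.
    by rewrite -jn; have := ltn_ord l; nia.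
  have h2 : `|L (pact (psum (s + j)) (u (i * s + e')%N))| <= T.
    apply: le_trans (Lk _ _ _) (rr _ _); last by rewrite -jn leq_addr.
    by rewrite leq_addr mul2n -addnn leq_add2l ltnW.
  have h3 : `|L (pact (psum s) (u (i * s + j + e')%N))| <= T.
    apply: le_trans (Lk _ _ _) (rr _ _); last by rewrite jn.
    by rewrite leqnn mul2n -addnn leq_addl.
  have h4 : i%:R * T <= n%:R / s%:R * T by rewrite ler_wpM2r.
  have -> : rho s ^+ n * (n%:R / s%:R + 2) * (A * rho s ^+ e') = n%:R / s%:R * T + 2 * T.
    by rewrite /T; ring.
  set a := (\sum_(l < i) _) in h1 *; set b := L (pact (psum (s + j)) _) in h2 *.
  set c := L (pact (psum s) _) in h3 *.
  have := ler_normD a (-1 * c + b); have := ler_normD (-1 * c) b.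
  by rewrite normrM normrN normr1 mul1r; lra.
rewrite iterS -/(u e); set v := resolvent mu s (u e).
have vw : wL2 s z v by exact: wL2_resolvent.
have [Ku uK] := uw e; have [Kv vK] := vw.
have Ku0 : 0 <= Ku by case: uK.
have Kv0 : 0 <= Kv by case: vK.
(* Stopping the Abel summation at [N] avoids evaluating [L] on an infinite series: the remainder,
   controlled by the continuity of [L] alone, is of order [(theta s * rho s ^+ 2) ^+ N] and vanishes
   in the limit. *)
apply: (@ler_geometric_limit _ _ (`|C| * (8 * s%:R * Ku + s%:R * Kv)) (theta s * rho s ^+ 2)).
  by rewrite theta_rho2_lt1// mulr_ge0 ?theta_ge0.
move=> N; have -> : s%:R *: v = pact (s%:R%:P) v by rewrite pactC.
rewrite (psum_geo s N) pactD pactM (@resolventK s z)// pactD pact_sum !pactZ.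
under eq_bigr do rewrite pactZ.
have pw n : wL2 s z (pact (psum n) (u e)) by exact: wL2_pact.
have sumw : wL2 s z (\sum_(n < N) geo s n *: pact (psum n) (u e)).
  elim: (N) => [|N' ihN]; first by rewrite big_ord0; exists 0; exact: wle0.
  by rewrite big_ord_recr; apply: wL2D => //; exact: wL2Z.
have Xw : wL2 s z (pact 'X^N v) by exact: wL2_pact.
rewrite LD ?LD//; try by [exact: wL2Z | apply: wL2D => //; exact: wL2Z].
rewrite (Lsum N (fun n => geo s n *: pact (psum n) (u e))); last by move=> n; exact: wL2Z.
under eq_bigr do rewrite LZ//.
rewrite !LZ//.
have h1 : `|\sum_(n < N) geo s n * L (pact (psum n) (u e))| <= 32 * (A * rho s ^+ e).
  apply: le_trans (ler_norm_sum _ _ _) _.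
  apply: le_trans (ler_wpM2r _ (sum_geo_le N s0)); last by rewrite mulr_ge0.
  rewrite mulr_suml; apply: ler_sum => n _.
  rewrite normrM (ger0_norm (geo_ge0 _ _)) -[leRHS]mulrA; apply: ler_wpM2l => //.
  exact: geo_ge0.
have t0 : 0 <= theta s ^+ N by rewrite exprn_ge0 ?theta_ge0.
(* The factor [N] lost on [psum N] is paid with one more power [rho s ^+ N]. *)
have N8 : N%:R <= 8 * s%:R * rho s ^+ N.
  have : N%:R / (8 * s%:R) <= rho s ^+ N.
    by rewrite rhoX; apply: le_trans (expR_ge1Dx _); rewrite lerDr.
  by rewrite ler_pdivrMr ?mulr_gt0// mulrC.
have r1 : 1 <= rho s ^+ N by rewrite exprn_ege1// rho_ge1.
have h2 : `|L (pact (psum N) (u e))| <= `|C| * (8 * s%:R * rho s ^+ N * rho s ^+ N * Ku).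
  apply: le_trans (C0 _ _ (wle_psum N s0 uK)) _.
  by rewrite ler_wpM2l// ler_wpM2r// ler_wpM2r.
have h3 : `|L (pact 'X^N v)| <= `|C| * (rho s ^+ N * rho s ^+ N * Kv).
  apply: le_trans (C0 _ _ (wle_iter N s0 vK)) _.
  by rewrite ler_wpM2l// ler_wpM2r// ler_peMl.
have -> : K0 * 32 ^+ M.+1 * rho s ^+ e = 32 * (A * rho s ^+ e) by rewrite /A exprS; ring.
rewrite (exprMn N (theta s)) (_ : rho s ^+ 2 ^+ N = rho s ^+ N * rho s ^+ N); last by rewrite -exprM mulnC exprM expr2.
have -> : `|C| * (8 * s%:R * Ku + s%:R * Kv) * (theta s ^+ N * (rho s ^+ N * rho s ^+ N)) =
  theta s ^+ N * (`|C| * (8 * s%:R * rho s ^+ N * rho s ^+ N * Ku)) +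
  theta s ^+ N * s%:R * (`|C| * (rho s ^+ N * rho s ^+ N * Kv)) by ring.
rewrite addrA; apply: le_trans (ler_normD _ _) _; apply: lerD.
  apply: le_trans (ler_normD _ _) _; apply: lerD => //.
  by rewrite normrM (ger0_norm t0) ler_wpM2l.
by rewrite normrM (ger0_norm (mulr_ge0 t0 (ltW s00))) ler_wpM2l// mulr_ge0.
Qed.


(** * Volume doubling, and pairing ball averages with weighted functions *)

Variable D : R.
Hypothesis D_gt0 : 0 < D.
Hypothesis doubling : forall x r, 0 < r -> vol mu x (2 * r) <= D * vol mu x r.

Lemma vol_pow x r j : 0 < r -> vol mu x (2 ^+ j * r) <= D ^+ j * vol mu x r.
Proof.
move=> r0; elim: j => [|j ih]; first by rewrite !expr0 !mul1r.
rewrite !exprS -!mulrA; apply: le_trans (doubling _ _) _; first by rewrite mulr_gt0 ?exprn_gt0.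
by rewrite ler_wpM2l// ltW.
Qed.

Lemma vol_gt0 x r : 0 < r -> 0 < vol mu x r.
Proof. by move=> r0; apply: lt_le_trans (mass_gt0 x) (vol_ge_mass x r0). Qed.

(** If [b <= 2 ^+ q.+1], then [b ^+ j] is at most the power [q.+1] of [2 ^+ j], which one term of
    the exponential series dominates. *)
Lemma pow_le_expR (b k : R) : 0 <= b -> 0 < k ->
  exists2 A : R, 0 < A & forall j : nat, b ^+ j <= A * expR (k * 2 ^+ j).
Proof.
move=> b0 k0; have [q bq] : exists q : nat, b <= 2 ^+ q.+1.
  exists (Num.trunc b); apply: le_trans (ltW (truncnS_gt b)) _.
  by rewrite -natrX ler_nat ltnW// ltn_expl.
exists (q.+1`!%:R / k ^+ q.+1) => [|j].
  by rewrite divr_gt0 ?exprn_gt0// ltr0n fact_gt0.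
set x := 2 ^+ j; have x0 : 0 <= x by rewrite exprn_ge0.
apply: (@le_trans _ _ (x ^+ q.+1)).
  by rewrite /x -exprM mulnC exprM; apply: lerXn2r; rewrite ?nnegrE ?exprn_ge0.
have := expR_ge1Dxn q (mulr_ge0 (ltW k0) x0); set e := expR _ => h.
have {}h : (k * x) ^+ q.+1 / q.+1`!%:R <= e by apply: le_trans h; rewrite lerDr.
move: h; rewrite ler_pdivrMr ?ltr0n ?fact_gt0// exprMn => h.
by rewrite mulrAC ler_pdivlMr ?exprn_gt0// mulrC (mulrC _ e).
Qed.

(** [j] is the least dyadic index whose ball contains [y], so [y] is outside the ball of index
    [j - 1] unless [j = 0]; the prefactor [expR (eps / 12)] covers that case. *)
Lemma shell_index s z y : (0 < s)%N -> exists2 j : nat,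
  dist z y < 2 ^+ j * Num.sqrt s%:R &
  (wgt s z y)^-1 <= expR (eps / 12) * expR (- (eps / 12 * 2 ^+ j)).
Proof.
move=> s0; set q := Num.sqrt _; have q1 : 1 <= q by exact: sqrt_ge1.
have q0 : 0 < q by apply: lt_le_trans q1.
have ex : exists n, dist z y < 2 ^+ n * q.
  exists (Num.trunc (dist z y)).+1; apply: lt_le_trans (truncnS_gt _) _.
  apply: (@le_trans _ _ (2 ^+ (Num.trunc (dist z y)).+1)).
    by rewrite -natrX ler_nat ltnW// ltn_expl.
  by rewrite ler_peMr// exprn_ge0.
case: (ex_minnP ex) => j jy jmin; exists j => //.
rewrite /wgt -expRN -expRD ler_expR /rate -/q.
have [j0|j0] := posnP j.
  by rewrite j0 expr0 mulr1 subrr oppr_le0 mulr_ge0 ?dist_ge0// divr_ge0 ?ltW// divr_gt0.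
have d2 : 2 ^+ j.-1 * q <= dist z y.
  rewrite leNgt; apply/negP => /jmin; lia.
rewrite -(prednK j0) exprS.
have h : eps / 6 * 2 ^+ j.-1 <= eps / 6 / q * dist z y.
  by rewrite [leRHS]mulrAC ler_pdivlMr// -[leLHS]mulrA ler_wpM2l// divr_ge0// ltW.
set t := 2 ^+ j.-1 in h *; have := eps_gt0.
set X := eps / 6 / q * dist z y in h *; lra.
Qed.

(** The points are sorted into dyadic balls around [z]. Doubling lets the volume grow like [D ^+ i],
    while the inverse weight is at most a constant over [(2 * D) ^+ i]; what is left is a geometric
    series of ratio [1 / 2]. *)
Lemma sum_inv_wgt : exists2 A : R, 0 < A & forall s z (E : seq G), (0 < s)%N -> uniq E ->
  \sum_(y <- E) mass mu y / wgt s z y <= A * vol mu z (Num.sqrt s%:R).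
Proof.
have e12 : 0 < eps / 12 by rewrite divr_gt0.
have [A A0 hA] := @pow_le_expR (2 * D) (eps / 12) (mulr_ge0 (ler0n _ 2) (ltW D_gt0)) e12.
pose c := expR (eps / 12) * A; have c0 : 0 < c by rewrite mulr_gt0// expR_gt0.
exists (c * 2) => [|s z E s0 uE]; first by rewrite mulr_gt0.
set q := Num.sqrt _; have q0 : 0 < q by rewrite sqrtr_gt0 ltr0n.
have D2 : 0 < 2 * D by rewrite mulr_gt0.
have /choice[j jP] : forall y, exists j : nat,
    dist z y < 2 ^+ j * q /\ (wgt s z y)^-1 <= c / (2 * D) ^+ j.
  move=> y; have [j jy jw] := shell_index z y s0; exists j; split=> //.
  apply: le_trans jw _; rewrite /c -[leRHS]mulrA ler_wpM2l ?expR_ge0//.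
  by rewrite ler_pdivlMr ?exprn_gt0// mulrC expRN ler_pdivrMr ?expR_gt0.
pose J := \max_(y <- E) (j y).+1.
have jJ y : y \in E -> (j y < J)%N.
  by move=> yE; apply: (@leq_bigmax_seq _ E xpredT (fun y => (j y).+1) y).
apply: (@le_trans _ _ (\sum_(y <- E) \sum_(i < J | dist z y < 2 ^+ i * q)
    mass mu y * (c / (2 * D) ^+ i))).
  rewrite big_seq [leRHS]big_seq; apply: ler_sum => y yE.
  rewrite (bigD1 (Ordinal (jJ y yE)))/=; last by case: (jP y).
  apply: (@le_trans _ _ (mass mu y * (c / (2 * D) ^+ j y))).
    by rewrite ler_wpM2l ?mass_ge0//; case: (jP y).
  rewrite lerDl sumr_ge0// => i _; rewrite mulr_ge0 ?mass_ge0// divr_ge0 ?exprn_ge0 ?ltW//.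
under eq_bigr do rewrite big_mkcond /=.
rewrite exchange_big /=.
apply: (@le_trans _ _ (\sum_(i < J) c * vol mu z q * 2^-1 ^+ i)).
  apply: ler_sum => i _; rewrite -big_mkcond /= -mulr_suml -big_filter.
  apply: (@le_trans _ _ (vol mu z (2 ^+ i * q) * (c / (2 * D) ^+ i))).
    apply: ler_wpM2r; first by rewrite divr_ge0 ?exprn_ge0 ?ltW.
    rewrite volE; apply: ler_sum_uniq_sub; rewrite ?filter_uniq ?bseq_uniq//.
    - by move=> y; rewrite mem_filter mem_bseq => /andP[].
    - by move=> y; exact: mass_ge0.
  apply: le_trans (ler_wpM2r _ (vol_pow z i q0)) _; first by rewrite divr_ge0 ?exprn_ge0 ?ltW.
  rewrite exprMn exprVn le_eqVlt; apply/predU1P; left.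
  by field; rewrite !expf_neq0// gt_eqF.
rewrite -mulr_sumr [leRHS]mulrAC; apply: ler_wpM2l; first by rewrite mulr_ge0 ?vol_ge0// ltW.
have : \sum_(i < J) 2^-1 ^+ i * (1 - 2^-1) <= 1 :> R.
  by rewrite -mulr_suml mulrC -opprB mulNr -subrX1 opprB gerBl exprn_ge0// invr_ge0.
by rewrite -mulr_suml; lra.
Qed.


(* Each [g x ^+ 2] is averaged over the centres [y] of the balls [B(y, sqrt s)] that
   contain [x]; this replaces a covering argument. *)
Lemma sum_sqr_inv_wgt : exists2 A : R, 0 < A & forall s z (g : G -> R) N (E : seq G),
  (0 < s)%N -> uniq E ->
  (forall y, \sum_(x <- bseq y (Num.sqrt s%:R)) g x ^+ 2 * mass mu x <=
     N ^+ 2 * vol mu y (Num.sqrt s%:R)) ->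
  \sum_(x <- E) g x ^+ 2 * mass mu x / wgt s z x <= A * N ^+ 2 * vol mu z (Num.sqrt s%:R).
Proof.
have [A A0 hA] := sum_inv_wgt; pose c := D * expR (eps / 6).
have c0 : 0 < c by rewrite mulr_gt0// expR_gt0.
exists (c * A) => [|s z g N E s0 uE gN]; first by rewrite mulr_gt0.
set q := Num.sqrt _ in gN *; have q0 : 0 < q by rewrite sqrtr_gt0 ltr0n.
pose a y := c / (vol mu y q * wgt s z y) * mass mu y.
have a0 y : 0 <= a y.
  apply: mulr_ge0 (mass_ge0 y); apply: divr_ge0; first exact: ltW.
  by rewrite mulr_ge0 ?vol_ge0 ?wgt_ge0.
have t0 x : 0 <= g x ^+ 2 * mass mu x by rewrite mulr_ge0 ?sqr_ge0 ?mass_ge0.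
(* The volume and the weight at a point [y] of [B(x, q)] exceed those at [x] by at most the factors
   [D] and [expR (eps / 6)], whose product is [c]; summing masses over the ball gives the bound. *)
have ge1 x : (wgt s z x)^-1 <= \sum_(y <- bseq x q) a y.
  rewrite -[leLHS]mul1r -(mulfV (lt0r_neq0 (vol_gt0 x q0))) [X in X / _ / _]volE.
  rewrite -mulrA mulr_suml big_seq [leRHS]big_seq; apply: ler_sum => y.
  rewrite mem_bseq => xy; rewrite mulrC /a; apply: ler_wpM2r; first exact: mass_ge0.
  rewrite -invfM -[leLHS]mul1r ler_pdivrMr ?mulr_gt0 ?vol_gt0 ?wgt_gt0// mulrAC.
  rewrite ler_pdivlMr ?mulr_gt0 ?vol_gt0 ?wgt_gt0// mul1r.
  have v : vol mu y q <= D * vol mu x q.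
    apply: le_trans (doubling x q0); apply: vol_le => w yw.
    by apply: le_lt_trans (dist_triangle x y w) _; rewrite mulrDl mul1r ltrD.
  have w : wgt s z y <= expR (eps / 6) * wgt s z x.
    rewrite -expRD ler_expR.
    have -> : eps / 6 + rate s * dist z x = rate s * (dist z x + q).
      by rewrite mulrDr addrC /rate mulfVK// gt_eqF.
    rewrite ler_wpM2l ?rate_ge0//; apply: le_trans (dist_triangle z x y) _.
    by rewrite lerD2l ltW.
  rewrite /c [leRHS]mulrACA; apply: ler_pM => //; [exact: vol_ge0 | exact: wgt_ge0].
pose E' := undup (flatten [seq bseq x q | x <- E]).
have uE' : uniq E' by rewrite undup_uniq.
apply: (@le_trans _ _ (\sum_(x <- E) \sum_(y <- E' | dist x y < q)
    g x ^+ 2 * mass mu x * a y)).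
  rewrite big_seq [leRHS]big_seq; apply: ler_sum => x xE; rewrite -mulr_sumr.
  apply: ler_wpM2l => //; apply: le_trans (ge1 x) _; rewrite le_eqVlt; apply/predU1P; left.
  rewrite (sum_uniq_restrict _ (bseq_uniq x q) uE'); last first.
    by move=> y yx; rewrite mem_undup; apply/flattenP; exists (bseq x q) => //; exact: map_f.
  by apply: eq_bigl => y; rewrite mem_bseq.
under eq_bigr do rewrite big_mkcond /=.
rewrite exchange_big /=.
apply: (@le_trans _ _ (\sum_(y <- E') a y * (N ^+ 2 * vol mu y q))).
  apply: ler_sum => y _; rewrite -big_mkcond /= -mulr_suml mulrC; apply: ler_wpM2l => //.
  apply: le_trans (gN y); rewrite -big_filter; apply: ler_sum_uniq_sub => //.
  - exact: filter_uniq.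
  - exact: bseq_uniq.
  - by move=> x; rewrite mem_filter mem_bseq dist_sym => /andP[].
have := ler_wpM2l (mulr_ge0 (ltW c0) (sqr_ge0 N)) (hA s z E' s0 uE').
rewrite -/q; congr (_ <= _); last by ring.
rewrite mulr_sumr; apply: eq_bigr => y _; rewrite /a.
by field; rewrite !gt_eqF ?vol_gt0 ?wgt_gt0.
Qed.

(** Cauchy-Schwarz between the weight and its inverse: [sum_sqr_inv_wgt] turns control of [g] on all
    balls of radius [sqrt s] into control in the dual norm. *)
Lemma pairing_le : exists2 A : R, 0 < A & forall s z (g psi : G -> R) N K (E : seq G),
  (0 < s)%N -> uniq E -> 0 <= N ->
  (forall y, \sum_(x <- bseq y (Num.sqrt s%:R)) g x ^+ 2 * mass mu x <=
     N ^+ 2 * vol mu y (Num.sqrt s%:R)) ->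
  wle (mass mu) (wgt s z) psi K ->
  `|\sum_(x <- E) g x * psi x * mass mu x| <=
    A * N * Num.sqrt (vol mu z (Num.sqrt s%:R)) * K.
Proof.
have [A A0 hA] := sum_sqr_inv_wgt.
exists (Num.sqrt A) => [|s z g psi N K E s0 uE N0 gN psiK]; first by rewrite sqrtr_gt0.
set v := vol mu z _; have v0 : 0 <= v by exact: vol_ge0.
have [K0 /(_ E uE) KE] := psiK.
have m0 x : 0 <= mass mu x / wgt s z x by rewrite divr_ge0 ?mass_ge0 ?wgt_ge0.
have := @weighted_cauchy_schwarz _ _ E (fun x => mass mu x / wgt s z x) g
  (fun x => wgt s z x * psi x) m0.
have w0 x : wgt s z x != 0 by rewrite gt_eqF// wgt_gt0.
have -> : \sum_(x <- E) mass mu x / wgt s z x * g x * (wgt s z x * psi x) =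
    \sum_(x <- E) g x * psi x * mass mu x.
  by apply: eq_bigr => x _; field.
have -> : \sum_(x <- E) mass mu x / wgt s z x * (wgt s z x * psi x) ^+ 2 =
    \sum_(x <- E) wgt s z x * psi x ^+ 2 * mass mu x.
  by apply: eq_bigr => x _; field.
have -> : \sum_(x <- E) mass mu x / wgt s z x * g x ^+ 2 =
    \sum_(x <- E) g x ^+ 2 * mass mu x / wgt s z x.
  by apply: eq_bigr => x _; field.
have gA := hA s z g N E s0 uE gN; set X := \sum_(x <- E) g x * psi x * mass mu x => XX.
have : X ^+ 2 <= (Num.sqrt A * N * Num.sqrt v * K) ^+ 2.
  apply: le_trans XX _; rewrite !exprMn (sqr_sqrtr (ltW A0)) (sqr_sqrtr v0).
  apply: ler_pM => //; apply: sumr_ge0 => x _.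
    by rewrite divr_ge0 ?wgt_ge0// mulr_ge0 ?sqr_ge0 ?mass_ge0.
  by rewrite mulr_ge0 ?mass_ge0// mulr_ge0 ?wgt_ge0 ?sqr_ge0.
rewrite -[X in X ^+ 2 <= _]/X -ler_sqrt ?sqr_ge0// !sqrtr_sqr => /le_trans; apply.
by rewrite ger0_norm// !mulr_ge0 ?sqrtr_ge0.
Qed.


(** * Finitely supported functions and operators acting on functionals *)

Lemma finitely_supportedP (f : G -> R) (E : seq G) :
  (forall x, f x != 0 -> x \in E) -> finitely_supported f.
Proof. by move=> fE; apply: (@sub_finite_set _ _ [set` E]) => [x /=|//]; exact: fE. Qed.

Lemma finitely_supportedD c (f g : G -> R) :
  finitely_supported f -> finitely_supported g -> finitely_supported (c *: f + g).
Proof.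
move=> ff fg; apply: (@sub_finite_set _ _ ([set x | f x != 0] `|` [set x | g x != 0])).
  move=> x; rewrite /mkset -[(_ + _) x]/(c * f x + g x) => h; have [f0|] := eqVneq (f x) 0; last by left.
  by right; move: h; rewrite f0 mulr0 add0r.
by rewrite finite_setU.
Qed.

Lemma finitely_supported0 : finitely_supported (0 : G -> R).
Proof. by apply: (@finitely_supportedP _ [::]) => x; rewrite eqxx. Qed.

Lemma finitely_supportedZ c (f : G -> R) : finitely_supported f -> finitely_supported (c *: f).
Proof. by move=> ff; rewrite -[c *: f]addr0; apply: finitely_supportedD => //; exact: finitely_supported0. Qed.

Lemma finitely_supported_markov f : finitely_supported f -> finitely_supported (markov_op mu f).
Proof.
move=> ff; apply: (@finitely_supportedP _ (flatten [seq nbrs x | x <- fset_set [set x | f x != 0]])).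
move=> x; apply: contraR => /flattenP nx; rewrite markov_nbrs big_seq big1 ?mul0r// => y yx.
have [->|fy] := eqVneq (f y) 0; first by rewrite mulr0.
case: nx; exists (nbrs y); last by rewrite mem_nbrs adj_sym -mem_nbrs.
by apply: map_f; rewrite in_fset_set// inE.
Qed.

Lemma finitely_supported_pact p f : finitely_supported f -> finitely_supported (pact p f).
Proof.
move=> ff; elim/poly_ind: p => [|p c ih]; first by rewrite pact0; exact: finitely_supported0.
rewrite pactD pactMX pactC -[markov_op _ _]scale1r.
by apply: finitely_supportedD; [exact: finitely_supported_markov | exact: finitely_supportedZ].
Qed.

Lemma pairing_seq (g phi : G -> R) (E : seq G) : uniq E -> (forall x, phi x != 0 -> x \in E) ->
  \sum_(x \in [set: G]) g x * phi x * mass mu x = \sum_(x <- E) g x * phi x * mass mu x.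
Proof.
move=> uE phiE; rewrite (fsbigE E)//=; first by apply: eq_bigl => y; rewrite in_setT.
move=> x _ xE; rewrite (_ : phi x = 0) ?mulr0 ?mul0r//.
by apply: contraNeq xE => /phiE.
Qed.

(** Testing on point masses gives the value [F (A (delta x)) / mass mu x] at [x], and linearity
    extends the identity to finite sums; [dual_op] then returns a function with this property. *)
Lemma dual_opE (A : (G -> R) -> G -> R) (F : (G -> R) -> R) :
  (forall c phi phi', finitely_supported phi -> finitely_supported phi' ->
     F (A (c *: phi + phi')) = c * F (A phi) + F (A phi')) ->
  forall phi, finitely_supported phi ->
    \sum_(x \in [set: G]) dual_op mu A F x * phi x * mass mu x = F (A phi).
Proof.
move=> FA; apply: (@xgetPex _ (fun=> 0) [set g : G -> R | forall phi, finitely_supported phi ->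
  \sum_(x \in [set: G]) g x * phi x * mass mu x = F (A phi)]).
pose delta (x : G) : G -> R := fun y => (x == y)%:R.
have fdelta x : finitely_supported (delta x).
  apply: (@finitely_supportedP _ [:: x]) => y; rewrite /delta inE (eq_sym y).
  by case: (x == y) => //; rewrite eqxx.
have FA0 : F (A 0) = 0.
  have := FA 1 _ _ finitely_supported0 finitely_supported0.
  by rewrite scale1r addr0 mul1r; lra.
exists (fun x => F (A (delta x)) / mass mu x) => phi fphi.
pose E : seq G := fset_set [set x | phi x != 0]; have uE : uniq E by exact: fset_uniq.
have memE x : (x \in E) = (phi x != 0).
  by rewrite in_fset_set//; apply/idP/idP; rewrite inE.
rewrite (@pairing_seq _ _ E)//; last by move=> x; rewrite memE.
transitivity (F (A (\sum_(x <- E) phi x *: delta x))); last first.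
  have dE x y : (phi x *: delta x) y = phi x * (x == y)%:R by [].
  congr (F (A _)); apply/funext => y; rewrite fct_sumE.
  have [yE|yE] := boolP (y \in E).
    rewrite (big_rem y)//= [X in _ + X]big_seq big1 => [|x].
      by rewrite addr0 dE eqxx mulr1.
    rewrite mem_rem_uniq// inE => /andP[xy _].
    by rewrite dE (negbTE xy) mulr0.
  rewrite big_seq big1 => [|x xE].
      by apply/esym/eqP; apply: contraNT yE => py; rewrite memE.
  rewrite dE; case: eqP => [xy|_]; last by rewrite mulr0.
  by rewrite -xy xE in yE.
have : finitely_supported (\sum_(x <- E) phi x *: delta x) /\
  F (A (\sum_(x <- E) phi x *: delta x)) = \sum_(x <- E) phi x * F (A (delta x)).
  elim: (E) => [|x r [fr ih]]; first by rewrite !big_nil; split=> //; exact: finitely_supported0.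
  by rewrite !big_cons FA// ih; split=> //; exact: finitely_supportedD.
case=> _ ->; apply: eq_bigr => x _.
by field; rewrite gt_eqF// mass_gt0.
Qed.

(** * Weighted functions as potentials in [M0] *)

Variable x0 : G.

Lemma M0norm_ge0 e psi : (0 <= M0norm mu x0 e psi)%E.
Proof.
apply: le_ereal_sup_tmp; eexists; first by exists 1%N.
by rewrite mule_ge0// ?poweR_ge0// lee_fin mulr_ge0 ?powR_ge0 ?sqrtr_ge0.
Qed.

(** The [- 2] makes the bound valid for [j = 1] as well, where the annulus is a full ball. *)
Lemma annulus_dist j y : (0 < j)%N -> annulus mu x0 1 j y -> 2 ^+ j - 2 <= dist x0 y.
Proof.
rewrite /annulus => j0; case: eqP => [->|_].
  by rewrite expr1 subrr dist_ge0.
move=> [_ ny]; have : 2 ^+ j <= dist x0 y.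
  by rewrite leNgt; apply/negP => h; apply: ny; apply/gballE; rewrite mulr1.
by lra.
Qed.

(** On the annulus [j] the weight forces decay like [expR (- (rate s / 2 * 2 ^+ j))], while by
    doubling the factor in front of the norm grows only geometrically in [j], whatever [e] is. *)
Lemma M0norm_le s e : (0 < s)%N -> exists2 C : R, 0 <= C & forall psi K,
  wle (mass mu) (wgt s x0) psi K -> (M0norm mu x0 e psi <= (C * K)%:E)%E.
Proof.
move=> s0; have k0 : 0 < rate s / 2 by rewrite divr_gt0// rate_gt0.
have b0 : 0 <= 2 `^ e * Num.sqrt D by rewrite mulr_ge0 ?powR_ge0 ?sqrtr_ge0.
have [A A0 hA] := pow_le_expR b0 k0.
set v := vol mu x0 1.
exists (A * Num.sqrt v * expR (rate s)) => [|psi K psiK].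
  by rewrite !mulr_ge0 ?sqrtr_ge0 ?expR_ge0// ltW.
have [K0 hK] := psiK.
apply: ge_ereal_sup => _ [j /= j0 <-].
set c := _ * Num.sqrt _.
have c0 : 0 <= c by rewrite mulr_ge0 ?powR_ge0 ?sqrtr_ge0.
have cA : c <= A * expR (rate s / 2 * 2 ^+ j) * Num.sqrt v.
  apply: le_trans (ler_wpM2r (sqrtr_ge0 v) (hA j)).
  rewrite /c (mulrC _ e) powRrM powR_mulrn ?powR_ge0// exprMn -[leRHS]mulrA.
  apply: ler_wpM2l; first by rewrite exprn_ge0// powR_ge0.
  rewrite -(ger0_norm (exprn_ge0 j (sqrtr_ge0 D))) -sqrtr_sqr -sqrtrM ?sqr_ge0//.
  apply: ler_wsqrtr; rewrite -exprM mulnC exprM sqr_sqrtr ?vol_pow//; exact: ltW.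
have psij : (L2norm mu (annulus mu x0 1 j) psi <= (expR (rate s - rate s / 2 * 2 ^+ j) * K)%:E)%E.
  apply: L2norm_le => [|r ur rj]; first by rewrite mulr_ge0 ?expR_ge0.
  apply: (@le_trans _ _ (expR (rate s - rate s / 2 * 2 ^+ j) ^+ 2 *
      \sum_(x <- r) wgt s x0 x * psi x ^+ 2 * mass mu x)).
    rewrite mulr_sumr big_seq [leRHS]big_seq; apply: ler_sum => x xr.
    rewrite -(mulrA (wgt s x0 x)) [leRHS]mulrA; apply: ler_peMl.
      by rewrite mulr_ge0 ?sqr_ge0 ?mass_ge0.
    rewrite -expRM_natl -expRD -[leLHS]expR0 ler_expR.
    have := annulus_dist j0 (rj x xr); have := rate_gt0 s0.
    set a := rate s; set t := 2 ^+ j; set d := dist _ _ => a0; rewrite -subr_ge0 => td.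
    by have := mulr_ge0 (ltW a0) td; congr (_ <= _); field.
  by rewrite exprMn ler_wpM2l ?sqr_ge0// hK.
apply: (@le_trans _ _ (c%:E * (expR (rate s - rate s / 2 * 2 ^+ j) * K)%:E)%E).
  by rewrite lee_wpmul2l// lee_fin.
rewrite -EFinM lee_fin mulrA; apply: ler_wpM2r => //.
apply: le_trans (ler_wpM2r (expR_ge0 _) cA) _.
rewrite expRB le_eqVlt; apply/predU1P; left; field.
by rewrite gt_eqF ?expR_gt0.
Qed.

Lemma M0_potential_wL2 s M e psi : (0 < s)%N -> wL2 s x0 psi ->
  M0_potential mu x0 M e (pact ((1 - 'X) ^+ M) psi) psi.
Proof.
move=> s0 psiw; split; first exact: wL2_L2 psiw.
  by rewrite -iter_lap_pact.
have [C C0 hC] := M0norm_le e s0; have [K psiK] := psiw.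
exact: le_lt_trans (hC _ _ psiK) (ltry _).
Qed.

Lemma M0_wL2 s M e psi : (0 < s)%N -> wL2 s x0 psi ->
  M0 mu x0 M e (pact ((1 - 'X) ^+ M) psi).
Proof.
move=> s0 psiw; split; last by exists psi; exact: (@M0_potential_wL2 s).
by apply: (@wL2_L2 s x0); exact: wL2_pact.
Qed.

(** * Elements of the dual of [M0], read through potentials *)

Section DualElement.
Variables (M : nat) (e : R) (F : (G -> R) -> R).
Hypothesis F_dual : M0_dual mu x0 M e F.

(** On weighted [L^2] this functional is linear and continuous, which is what
    [functional_resolvent_le] asks for. *)
Definition on_potential (psi : G -> R) : R := F (pact ((1 - 'X) ^+ M) psi).

Lemma on_potential_linear s c f g : (0 < s)%N -> wL2 s x0 f -> wL2 s x0 g ->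
  on_potential (c *: f + g) = c * on_potential f + on_potential g.
Proof.
move=> s0 fw gw; rewrite /on_potential pactDf pactZf.
by apply: F_dual.1; exact: (@M0_wL2 s).
Qed.

Lemma on_potential_bounded s : (0 < s)%N ->
  exists C, forall f K, wle (mass mu) (wgt s x0) f K -> `|on_potential f| <= C * K.
Proof.
move=> s0; have [C hC] := F_dual.2; have [B B0 hB] := M0norm_le e s0.
exists (`|C| * B) => f K fK; rewrite -lee_fin.
have fw : wL2 s x0 f by exists K.
apply: le_trans (hC _ _ (M0_wL2 M e s0 fw) (M0_potential_wL2 M e s0 fw)) _.
apply: (@le_trans _ _ (`|C|%:E * M0norm mu x0 e f)%E).
  by rewrite lee_wpmul2r ?M0norm_ge0// lee_fin ler_norm.
by rewrite -mulrA EFinM lee_wpmul2l ?lee_fin// hB.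
Qed.

(** Each factor [1 - 'X^k] is [(1 - 'X) * psum k], so the product of the [psum k] applied to [phi]
    is a potential. *)
Lemma opBZ1_on_potential ks phi : size ks = M ->
  F (opBZ1 mu ks phi) = on_potential (pact (\prod_(k <- ks) psum k) phi).
Proof.
move=> ksM; rewrite opBZ1_pact /on_potential -pactM; congr (F (pact _ _)).
elim: ks M ksM => [|k ks ih] _ <-; first by rewrite !big_nil expr0 mulr1.
rewrite !big_cons exprS (ih (size ks))// -psumP; ring.
Qed.

Lemma opBZ2_on_potential s phi : (0 < s)%N -> wL2 s x0 phi ->
  F (opBZ2 mu M s phi) = on_potential (iter M (fun g => s%:R *: resolvent mu s g) phi).
Proof. by move=> s0 phiw; rewrite (@opBZ2_potential s x0). Qed.

Lemma dual_opBZ1 ks phi : size ks = M -> finitely_supported phi ->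
  \sum_(x \in [set: G]) dual_op mu (opBZ1 mu ks) F x * phi x * mass mu x = F (opBZ1 mu ks phi).
Proof.
move=> ksM; apply: dual_opE => c f g ff fg; rewrite !opBZ1_on_potential// pactDf pactZf.
by apply: (@on_potential_linear 1) => //; apply: wL2_pact => //; exact: wL2_supp.
Qed.

Lemma dual_opBZ2 s phi : (0 < s)%N -> finitely_supported phi ->
  \sum_(x \in [set: G]) dual_op mu (opBZ2 mu M s) F x * phi x * mass mu x = F (opBZ2 mu M s phi).
Proof.
move=> s0; apply: dual_opE => c f g ff fg.
have fw : wL2 s x0 f by exact: wL2_supp.
have gw : wL2 s x0 g by exact: wL2_supp.
rewrite !opBZ2_on_potential//; last by apply: wL2D => //; exact: wL2Z.
rewrite -(@on_potential_linear s)//; try exact: wL2_iter.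
congr on_potential.
exact: (@iter_resolventD s x0).
Qed.

End DualElement.


(** * Comparison of the two norms by duality on balls *)

Lemma ball_mean2_le s z g N : (0 < s)%N -> 0 <= N ->
  ball_mean2 mu z (Num.sqrt s%:R) g <= N <->
  \sum_(x <- bseq z (Num.sqrt s%:R)) g x ^+ 2 * mass mu x <= N ^+ 2 * vol mu z (Num.sqrt s%:R).
Proof.
move=> s0 N0; set q := Num.sqrt _; have q0 : 0 < q by rewrite sqrtr_gt0 ltr0n.
rewrite /ball_mean2 fsbig_finite; last exact: finite_gball.
under eq_bigr do rewrite real_normK ?num_real//.
rewrite -/(bseq z q) -{1}(sqr_sqrtr N0); set S := \sum_(x <- _) _.
have S0 : 0 <= S by apply: sumr_ge0 => x _; rewrite mulr_ge0 ?sqr_ge0 ?mass_ge0.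
have v0 := vol_gt0 z q0.
have T0 : 0 <= (vol mu z q)^-1 * S by rewrite mulr_ge0// invr_ge0 ltW.
rewrite sqr_sqrtr// -[N in X in X <-> _]ger0_norm// -sqrtr_sqr ler_sqrt ?sqr_ge0//.
by rewrite mulrC ler_pdivrMr.
Qed.

(** Closes the duality argument: testing a function against its own restriction to a ball leaves a
    factor [Num.sqrt S] on the right, to be divided out. *)
Lemma sqrt_absorb (S v c : R) : 0 <= S -> 0 <= v -> 0 <= c ->
  S <= c * Num.sqrt v * Num.sqrt S -> S <= c ^+ 2 * v.
Proof.
move=> S0 v0 c0; rewrite -(sqr_sqrtr S0) -(sqr_sqrtr v0).
move: (sqrtr_ge0 S) (sqrtr_ge0 v); move: (Num.sqrt S) (Num.sqrt v) => a b a0 b0.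
rewrite !sqrtr_sqr !ger0_norm// -exprMn => h; apply: lerXn2r; rewrite ?nnegrE ?mulr_ge0//.
move: a0 h; rewrite le_eqVlt => /predU1P[<- _|a0]; first by rewrite mulr_ge0.
by rewrite expr2 ler_pM2r.
Qed.

(** Within distance [sqrt s] of [z] the weight is at most [expR (eps / 6)], whose square root is the
    constant. *)
Lemma wle_ball s z (E : seq G) f : (0 < s)%N -> uniq E ->
  (forall x, f x != 0 -> x \in E) -> {in E, forall x, dist z x < Num.sqrt s%:R} ->
  wle (mass mu) (wgt s z) f (expR (eps / 12) * Num.sqrt (\sum_(x <- E) f x ^+ 2 * mass mu x)).
Proof.
move=> s0 uE fE Ez; have q0 : 0 < Num.sqrt s%:R :> R by rewrite sqrtr_gt0 ltr0n.
apply: wle_le (wle_supp mass_gt0 (wgt_ge0 s z) uE fE).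
have e0 := expR_ge0 (eps / 12).
rewrite -(ger0_norm e0) -sqrtr_sqr -sqrtrM ?sqr_ge0//; apply: ler_wsqrtr.
rewrite mulr_sumr big_seq [leRHS]big_seq; apply: ler_sum => x xE.
rewrite -mulrA; apply: ler_wpM2r; first by rewrite mulr_ge0 ?sqr_ge0 ?mass_ge0.
rewrite -expRM_natl ler_expR; have -> : 2%:R * (eps / 12) = rate s * Num.sqrt s%:R.
  by rewrite /rate mulfVK ?gt_eqF//; field.
by rewrite ler_wpM2l ?rate_ge0// ltW// Ez.
Qed.

Lemma BMO_comparison (M : nat) : exists2 C : R, 0 < C &
  forall F, Defs.EM mu x0 M F -> forall N : R, 0 <= N ->
  ((forall s (ks : seq nat) y, (0 < s)%N -> size ks = M -> all (fun k => s <= k <= 2 * s)%N ks ->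
      ball_mean2 mu y (Num.sqrt s%:R) (dual_op mu (opBZ1 mu ks) F) <= N) ->
   forall s z, (0 < s)%N ->
      ball_mean2 mu z (Num.sqrt s%:R) (dual_op mu (opBZ2 mu M s) F) <= C * N) /\
  ((forall s y, (0 < s)%N ->
      ball_mean2 mu y (Num.sqrt s%:R) (dual_op mu (opBZ2 mu M s) F) <= N) ->
   forall s (ks : seq nat) z, (0 < s)%N -> size ks = M ->
      all (fun k => s <= k <= 2 * s)%N ks ->
      ball_mean2 mu z (Num.sqrt s%:R) (dual_op mu (opBZ1 mu ks) F) <= C * N).
Proof.
have [A A0 hA] := pairing_le; pose b := expR (eps / 12); have b0 : 0 < b by exact: expR_gt0.
(* [A] comes from the pairing, [b] from the weight on a ball, [32 ^+ M] from the resolvents; it also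
   covers the factor [7 ^+ M] of the other direction. *)
exists (A * b * 32 ^+ M) => [|F [e /= e0 Fd] N N0]; first by rewrite !mulr_gt0 ?exprn_gt0.
have C0 : 0 <= A * b * 32 ^+ M by rewrite !mulr_ge0 ?exprn_ge0// ltW.
(* Duality: it suffices to bound the functional [L] represented by [g], which is tested on [g] cut
   off to the ball. *)
have reduce s z g (L : (G -> R) -> R) : (0 < s)%N ->
  (forall phi, finitely_supported phi ->
     \sum_(x \in [set: G]) g x * phi x * mass mu x = L phi) ->
  (forall phi K, finitely_supported phi -> wle (mass mu) (wgt s z) phi K ->
     `|L phi| <= A * N * Num.sqrt (vol mu z (Num.sqrt s%:R)) * K * 32 ^+ M) ->
  ball_mean2 mu z (Num.sqrt s%:R) g <= A * b * 32 ^+ M * N.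
  move=> s0 gL Lle; have v0 := vol_ge0 z (Num.sqrt s%:R).
  apply/ball_mean2_le => //; first by rewrite mulr_ge0.
  set E := bseq z _; set S := \sum_(x <- E) _.
  have S0 : 0 <= S by apply: sumr_ge0 => x _; rewrite mulr_ge0 ?sqr_ge0 ?mass_ge0.
  apply: sqrt_absorb => //; first by rewrite mulr_ge0.
  pose phi x := if x \in E then g x else 0.
  have phiE x : phi x != 0 -> x \in E by rewrite /phi; case: ifP => //; rewrite eqxx.
  have fphi : finitely_supported phi by exact: finitely_supportedP phiE.
  have Sphi : S = \sum_(x <- E) phi x ^+ 2 * mass mu x.
    by rewrite /S big_seq [RHS]big_seq; apply: eq_bigr => x xE; rewrite /phi xE.
  have := gL phi fphi; rewrite (pairing_seq g (bseq_uniq z _) phiE) -/E.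
  have -> : \sum_(x <- E) g x * phi x * mass mu x = S.
    by rewrite /S big_seq [RHS]big_seq; apply: eq_bigr => x xE; rewrite /phi xE expr2.
  move=> SL; rewrite {1}SL; apply: le_trans (ler_norm _) _.
  have phiw : wle (mass mu) (wgt s z) phi (b * Num.sqrt S).
    by rewrite Sphi; apply: wle_ball => //; [exact: bseq_uniq | move=> x; rewrite mem_bseq].
  apply: le_trans (Lle _ _ fphi phiw) _.
  by rewrite le_eqVlt; apply/predU1P; left; ring.
split=> [h1 s z s0|h2 s ks z s0 ksM kss].
  apply: (reduce s z _ (fun phi => F (opBZ2 mu M s phi)) s0).
    by move=> phi; exact: (dual_opBZ2 Fd).
  move=> phi K fphi phiK; rewrite (@opBZ2_on_potential M F s phi s0 (wL2_supp _ _ fphi)).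
  have K0 : 0 <= K by case: phiK.
  (* Linearity and continuity of [on_potential] are known for the weight centred at [x0], whereas
     the constant is measured with the weight centred at [z]. *)
  have := @functional_resolvent_le s x0 phi M (on_potential M F)
    (A * N * Num.sqrt (vol mu z (Num.sqrt s%:R)) * K) s0 (wL2_supp _ _ fphi).
  move=> /(_ _ _ _ _ 0%N); rewrite expr0 pact1 mulr1; apply.
  - by rewrite !mulr_ge0 ?sqrtr_ge0// ltW.
  - by move=> c f g fw gw; exact: (@on_potential_linear M e F Fd s c f g s0 fw gw).
  - exact: (on_potential_bounded Fd).
  move=> ks e' ksM kss; rewrite pactM -opBZ1_on_potential//.
  have fX : finitely_supported (pact 'X^e' phi) by exact: finitely_supported_pact.
  rewrite -(dual_opBZ1 Fd ksM fX).
  have XE x : pact 'X^e' phi x != 0 -> x \in (fset_set [set x | pact 'X^e' phi x != 0] : seq G).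
    by move=> h; rewrite in_fset_set// inE.
  rewrite (pairing_seq _ (fset_uniq _) XE) -mulrA [K * _]mulrC.
  apply: hA => //; last exact: wle_iter.
  by move=> y; apply/ball_mean2_le => //; exact: h1.
apply: (reduce s z _ (fun phi => F (opBZ1 mu ks phi)) s0).
  by move=> phi; exact: (dual_opBZ1 Fd ksM).
move=> phi K fphi phiK; have K0 : 0 <= K by case: phiK.
(* [opBZ1] applied to [phi] is [opBZ2] applied to [T], which stays finitely supported because [Tpol]
   is a polynomial in [P]. *)
rewrite -(@opBZ2_Tpol s z)//; last exact: wL2_supp.
set T := pact _ phi; have fT : finitely_supported T by exact: finitely_supported_pact.
rewrite ksM -(dual_opBZ2 Fd s0 fT).
have TE x : T x != 0 -> x \in (fset_set [set x | T x != 0] : seq G).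
  by move=> h; rewrite in_fset_set// inE.
rewrite (pairing_seq _ (fset_uniq _) TE).
apply: (@le_trans _ _ (A * N * Num.sqrt (vol mu z (Num.sqrt s%:R)) * (7 ^+ M * K))).
  apply: hA => //.
    by move=> y; apply/ball_mean2_le => //; exact: h2.
  rewrite -ksM; apply: wle_prod_Tpol => //.
  by apply: sub_all kss => k /andP[].
rewrite -[leRHS]mulrA [K * _]mulrC; apply: ler_wpM2l.
  by rewrite !mulr_ge0 ?sqrtr_ge0// ltW.
by apply: ler_wpM2r => //; apply: lerXn2r; rewrite ?nnegrE// ler_nat.
Qed.

End WeightedGraphs.

Theorem theorem1p34 (R : realType) (G : choiceType) (mu : G -> G -> R)
    (hmu : weighted_graph mu) (hDV : DV mu) (hLB : LB mu)
    (x0 : G) (M : nat) (hM : (0 < M)%N) :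
  BMO1 mu x0 M = BMO2 mu x0 M /\
  exists2 C : R, 0 < C &
    forall F : (G -> R) -> R, BMO1 mu x0 M F ->
      (BMO1_norm mu M F <= C%:E * BMO2_norm mu M F)%E /\
      (BMO2_norm mu M F <= C%:E * BMO1_norm mu M F)%E.
Proof.
have [D D0 hD] := hDV; have [eps eps0 heps] := hLB.
have [C C0 hC] := BMO_comparison hmu eps0 heps D0 hD x0 M.
have ge0_1 F : (0 <= BMO1_norm mu M F)%E.
  apply: le_ereal_sup_tmp; eexists.
    by exists 1%N, (nseq_tuple M 1%N), x0; split=> //; apply/allP => k /nseqP[->].
  by rewrite lee_fin sqrtr_ge0.
have ge0_2 F : (0 <= BMO2_norm mu M F)%E.
  apply: le_ereal_sup_tmp; eexists; first by exists 1%N, x0.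
  by rewrite lee_fin sqrtr_ge0.
have le12 F : Defs.EM mu x0 M F -> (BMO1_norm mu M F <= C%:E * BMO2_norm mu M F)%E.
  (* A finite norm serves as [N]; nonnegativity excludes [-oo], and for [+oo] the bound is trivial
     since [C > 0]. *)
  move=> FE; have := ge0_2 F; case E2 : (BMO2_norm mu M F) => [N| |]// N0; last first.
    by rewrite gt0_muley ?lte_fin// leey.
  have [_ /(_ _) h] := hC F FE N N0.
  apply: ge_ereal_sup => _ [s [ss [z [s0 kss ->]]]]; rewrite -EFinM lee_fin.
  apply: h => //; last exact: size_tuple.
  move=> s' y s'0; rewrite -lee_fin -E2; apply: ereal_sup_ubound.
  by exists s', y.
have le21 F : Defs.EM mu x0 M F -> (BMO2_norm mu M F <= C%:E * BMO1_norm mu M F)%E.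
  move=> FE; have := ge0_1 F; case E1 : (BMO1_norm mu M F) => [N| |]// N0; last first.
    by rewrite gt0_muley ?lte_fin// leey.
  have [/(_ _) h _] := hC F FE N N0.
  apply: ge_ereal_sup => _ [s [z [s0 ->]]]; rewrite -EFinM lee_fin.
  apply: h => // s' ks y s'0 ksM kss; rewrite -lee_fin -E1; apply: ereal_sup_ubound.
  by exists s', (Tuple (introT eqP ksM)), y.
split; last by exists C => // F [FE _]; split; [exact: le12 | exact: le21].
(* Both comparisons hold for every [F] in [EM], so finiteness of one norm gives that of the
   other. *)
have fin (a b : \bar R) : (a <= C%:E * b)%E -> (0 <= b)%E -> (b < +oo)%E -> (a < +oo)%E.
  by move=> ab b0 bf; apply: le_lt_trans ab _; rewrite lte_mul_pinfty// ?lee_fin ?ltW.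
apply/seteqP; split=> F [FE Ff]; split=> //.
  exact: fin (le21 F FE) (ge0_1 F) Ff.
exact: fin (le12 F FE) (ge0_2 F) Ff.
Qed.
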